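(* Let $m,n,d$ be positive integers and let $p$ be a positive multiple of $n$. Let $Q$ be a noncommutative multilinear polynomial of degree $d$ in $m$ variables with coefficients in $M_n(\mathbb{C})$ such that $\|Q(\sigma)\|\le 1$ for all $\sigma\in\{-1,1\}^m$. Let $\tau:=\max_{i=1,\dots,m}\sum_{S\subseteq\{1,\dots,m\}:\, i\in S}\mathrm{Tr}(\widehat{Q}(S)\widehat{Q}(S)^* )$ be the maximum influence of $Q$. Let $\mathcal{G}$ be a distribution on $M_n(\mathbb{C})$ such that $G\sim\mathcal{G}$ satisfies $\mathbb{E}G=0$ and $\mathbb{E}GG^*=I$, and let $c_2\ge 1$ be such that $\|\mathbb{E}(GG^* )^2\|\le c_2$. Then $$\mathbb{E}_{G_i\sim\mathcal{G}\otimes I,\;H_i\sim\mathcal{H}_p}\frac1n\mathrm{Tr}\,\big|Q^{\iota}\{G_iH_i\}\big|^4\;\le\;\mathbb{E}_{b_i\sim\mathcal{B}}\frac1n\mathrm{Tr}\,\big|Q\{b_i\}\big|^4+8(8c_2)^{4d}n^4\tau^{1/4}+O_{m,n}(p^{-1/2}).$$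
   Context: A noncommutative multilinear polynomial of degree $d$ in $m$ variables is an expression $Q(X_1,\dots,X_m)=\sum_{S\subseteq\{1,\dots,m\}:|S|\le d}\widehat{Q}(S)\prod_{i\in S}X_i$, where $\widehat{Q}(S)\in M_n(\mathbb{C})$, the $X_i$ are noncommuting $n\times n$ matrix variables, and products are taken in increasing order of the index; the degree is $\max\{|S|:\widehat Q(S)\ne0\}$. Scalars $\sigma_i$ are substituted as $\sigma_i I$, and $Q\{A_i\}$ denotes $Q(A_1,\dots,A_m)$. For $A\in M_n(\mathbb{C})$, $\iota(A)=\begin{pmatrix}A&0\\0&0\end{pmatrix}\in M_p(\mathbb{C})$, and $Q^{\iota}(X_1,\dots,X_m)=\sum_{S}\iota(\widehat{Q}(S))\prod_{i\in S}X_i$ for $p\times p$ matrix variables $X_i$. $|A|=(AA^* )^{1/2}$; $\|A\|$ is the operator norm; $\mathrm{Tr}$ is the unnormalized trace. $b_i\sim\mathcal{B}$: $b_1,\dots,b_m$ are independent uniform on $\{-1,1\}$. $G_i\sim\mathcal{G}\otimes I$: $G_i=G_i'\otimes I_{p/n}\in M_p(\mathbb{C})$ with $G_1',\dots,G_m'$ i.i.d. of distribution $\mathcal{G}$. $H_i\sim\mathcal{H}_p$: $H_1,\dots,H_m$ are independent $p\times p$ Haar-distributed random unitary matrices. All these random variables are independent. $a=O_c(b)$ means that $|a|\le C(c)|b|$ for a constant $C(c)>0$ depending on $c$. *)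

(* Defs.v *)
From HB Require Import structures.
From mathcomp Require Import all_boot all_order all_algebra.
From mathcomp Require Import sesquilinear spectral.
From mathcomp Require Import complex mxtens.
From mathcomp Require Import all_classical all_reals all_analysis.

Set Implicit Arguments.
Unset Strict Implicit.
Unset Printing Implicit Defensive.

Import Order.TTheory GRing.Theory Num.Theory.

Local Open Scope classical_set_scope.
Local Open Scope ring_scope.
Local Open Scope sesquilinear_scope.

Section matrices.
Variable R : realType.
Local Notation C := R[i].

Definition l2norm n (x : 'cV[C]_n) : R :=
  Num.sqrt (\sum_i (complex.Re (x i 0) ^+ 2 + complex.Im (x i 0) ^+ 2)).

Definition opnorm n (A : 'M[C]_n) : R :=
  sup [set l2norm (A *m x) | x in [set x : 'cV[C]_n | l2norm x <= 1]].

(* |A| = (A A^* )^(1/2), by functional calculus on the spectral decomposition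
   of the Hermitian matrix A A^*. *)
Definition absmx n (A : 'M[C]_n) : 'M[C]_n :=
  let B := A *m A ^t* in
  invmx (spectralmx B) *m diag_mx (map_mx (fun z : C => sqrtC z) (spectral_diag B))
    *m spectralmx B.

Lemma absmx_sqr n (A : 'M[C]_n) : absmx A *m absmx A = A *m A ^t*.
Proof.
have nB : A *m A ^t* \is normalmx.
  apply/normalmxP; suff -> : (A *m A ^t*) ^t* = A *m A ^t* by [].
  by rewrite trmx_mul map_mxM trmxCK.
rewrite /absmx !mulmxA mulmxK ?spectral_unit// -(mulmxA (invmx _)) mulmx_diag.
rewrite [RHS](orthomx_spectralP nB); congr (_ *m diag_mx _ *m _).
by apply/rowP => i; rewrite !mxE -expr2 sqrtCK.
Qed.

Definition retr n (A : 'M[C]_n) : R := complex.Re (\tr A).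

(* The matrix with upper-left block A and zeros elsewhere (for n <= p). *)
Definition embmx n p (A : 'M[C]_n) : 'M[C]_p :=
  (pid_mx n : 'M[C]_(p, n)) *m A *m (pid_mx n : 'M[C]_(n, p)).

Lemma embmx_block n q (A : 'M[C]_n) :
  embmx (n + q) A = block_mx A 0 0 (0 : 'M[C]_q).
Proof.
rewrite /embmx pid_mx_row pid_mx_col mul_col_mx mul1mx mul0mx.
by rewrite mul_col_row mulmx1 mulmx0 mul0mx mulmx0.
Qed.

End matrices.

Section ncpoly.
Variable R : realType.
Local Notation C := R[i].

(* Coefficients hat Q(S) of a noncommutative multilinear polynomial. *)
Definition ncpoly m n := {ffun {set 'I_m} -> 'M[C]_n}.

Definition ncdeg m n (Q : ncpoly m n) : nat := (\max_(S | Q S != 0%R) #|S|)%N.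

(* The index type 'I_m is enumerated increasingly, so the inner (noncommutative)
   product is taken in increasing order of the index. *)
Definition nceval m n (Q : ncpoly m n) (X : 'I_m -> 'M[C]_n) : 'M[C]_n :=
  \sum_(S : {set 'I_m}) Q S *m \prod_(i < m | i \in S) X i.

Definition ncemb m n p (Q : ncpoly m n) : ncpoly m p := [ffun S => embmx p (Q S)].

(* b encodes the sign vector sigma_i = (-1)^(b i). *)
Definition ncsign m n (Q : ncpoly m n) (b : {ffun 'I_m -> bool}) : 'M[C]_n :=
  nceval Q (fun i => ((-1) ^+ b i)%:M).

(* All influences are nonnegative, so the base value 0 is harmless. *)
Definition maxinf m n (Q : ncpoly m n) : R :=
  \big[Num.max/0]_(i < m) \sum_(S : {set 'I_m} | i \in S) retr (Q S *m (Q S) ^t*).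

(* Expectation over independent uniform signs. *)
Definition Esign m (f : {ffun 'I_m -> bool} -> R) : R :=
  (2 ^+ m)^-1 * \sum_b f b.

End ncpoly.

Section cmx.
Variables (R : realType) (n : nat).

Definition cmx_pt : Type := 'M[R[i]]_n.
HB.instance Definition _ := Choice.on cmx_pt.
HB.instance Definition _ := isPointed.Build cmx_pt (0 : 'M[R[i]]_n).

(* Generators of the Borel sigma-algebra of M_n(C) = R^(2 n^2): the preimages of
   Borel sets of R under the real and imaginary parts of the entries. *)
Definition cmx_gen : set (set cmx_pt) :=
  [set A | exists i j (B : set R), measurable B /\
     (A = [set M : 'M[R[i]]_n | B (complex.Re (M i j))] \/
      A = [set M : 'M[R[i]]_n | B (complex.Im (M i j))])].

Definition cmx := g_sigma_algebraType cmx_gen.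

HB.instance Definition _ := Measurable.on cmx.

End cmx.

Section random_matrices.
Variable R : realType.

Definition mx_integrable d (T : measurableType d) (P : probability T R) n
    (X : T -> 'M[R[i]]_n) : Prop :=
  forall i j,
    P.-integrable setT (fun w => (complex.Re (X w i j))%:E) /\
    P.-integrable setT (fun w => (complex.Im (X w i j))%:E).

Definition Emx d (T : measurableType d) (P : probability T R) n
    (X : T -> 'M[R[i]]_n) : 'M[R[i]]_n :=
  \matrix_(i, j) Complex (fine 'E_P[fun w => complex.Re (X w i j)])
                         (fine 'E_P[fun w => complex.Im (X w i j)]).

Definition has_distribution d d' (T : measurableType d) (E : measurableType d')
    (P : probability T R) (X : {RV P >-> E}) (mu : probability E R) : Prop :=
  forall A : set E, measurable A -> distribution P X A = mu A.

(* The Haar probability measure of the compact group U(p), as a measure on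
   M_p(C) carried by U(p) and invariant under its translations. *)
Definition haar_unitary p (mu : probability (cmx R p) R) : Prop :=
  mu [set M | (M : 'M[R[i]]_p) \is unitarymx] = 1%E /\
  forall (U : 'M[R[i]]_p) (A : set (cmx R p)), U \is unitarymx -> measurable A ->
    mu [set M | A (U *m (M : 'M[R[i]]_p))] = mu A /\
    mu [set M | A ((M : 'M[R[i]]_p) *m U)] = mu A.

(* Mutual independence of a finite family of sigma-algebras. *)
Definition mutually_independent d (T : measurableType d) (P : probability T R)
    (I : finType) (F : I -> set (set T)) : Prop :=
  forall (J : {set I}) (A : I -> set T), (forall i, i \in J -> F i (A i)) ->
    P (\bigcap_(i in [set` J]) A i) = (\prod_(i in J) P (A i))%E.

Definition independent_GH d (T : measurableType d) (P : probability T R) m n p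
    (G : 'I_m -> {RV P >-> cmx R n}) (H : 'I_m -> {RV P >-> cmx R p}) : Prop :=
  mutually_independent P (fun s : 'I_m + 'I_m => match s with
    | inl i => g_sigma_algebra_preimage (G i)
    | inr i => g_sigma_algebra_preimage (H i)
    end).

End random_matrices.

(* Main.v *)
Require Import Defs.
From HB Require Import structures.
From mathcomp Require Import all_boot all_order all_algebra.
From mathcomp Require Import fingroup perm.
From mathcomp Require Import sesquilinear spectral.
From mathcomp Require Import complex mxtens.
From mathcomp Require Import all_classical all_reals all_analysis.
From mathcomp Require Import measurable_realfun.
From mathcomp Require Import ring lra.

(* A direct moment computation replaces hypercontractivity. Let J be the inclusion
   C^n -> C^p, X_S the product of the X_i = G_i H_i over i in S, and V_S = hatQ(S) J^* X_S,
   so that the left-hand side is E |V V^*|_2^2 / n with V = sum_S V_S. Split V V^* = D + O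
   with D = sum_S V_S V_S^* and O the off-diagonal part.
   - If S <> S', averaging over the Haar unitary of the largest index in which S and S'
     differ gives E |J^* X_S X_{S'}^* J|_2^2 = O(1/p). Hence E |O|_2^2 = O(1/p), and the
     cross terms with D are O(p^{-1/2}).
   - E |D|_2^2 = sum_{A,B} E <V_A V_A^*, V_B V_B^*>. For disjoint A and B the mean
     E G G^* = I gives |hatQ(A)^* hatQ(B)|_2^2; the sum of these is bounded by the Boolean
     fourth moment, by Jensen's inequality applied to Q(b) Q(b)^*.
   - If A meets B, then E |J^* X_A X_A^* J|_2^2 <= n c_2^|A| bounds the term by
     n c_2^d |hatQ(A)|_2^2 |hatQ(B)|_2^2, and these sum to at most n^2 d c_2^d tau.
   The constant in O(p^{-1/2}) does not depend on c_2: every term in which c_2 occurs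
   carries a power of tau, so for c_2 large it is absorbed in the influence term. *)

Set Implicit Arguments.
Unset Strict Implicit.
Unset Printing Implicit Defensive.

Import Order.TTheory GRing.Theory Num.Theory.

Local Open Scope classical_set_scope.
Local Open Scope ring_scope.
Local Open Scope sesquilinear_scope.

(** * Frobenius norm, operator norm and ampliation *)

Section frobenius.
Variable R : realType.
Local Notation C := R[i].

(** The matrices G_i are unbounded, with moments controlled only up to order four. So the estimates
    on the random matrices are inequalities between integrals of nonnegative functions: Tonelli then
    applies to each variable in turn, with no integrability of words to establish beforehand. For
    the same reason the cross terms between D and O are removed pointwise, by 2<D,O> <= e |D|_2^2 +
    e^-1 |O|_2^2, before anything is integrated. With e = p^{-1/2} the diagonal part loses e and the
    off-diagonal part, already O(e^2), loses e^-1; both errors are O(p^{-1/2}). The order of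
    elimination depends on the term. A diagonal word is consumed from its rightmost letter, which
    stands in the middle of X_A X_A^*, whereas an off-diagonal product is averaged at one interior
    letter. So any one variable must be separable from all the others, and the sample space is kept
    while its sigma-algebra is shrunk to that of the remaining variables. *)

Lemma ReM (x y : C) : complex.Re (x * y) =
  complex.Re x * complex.Re y - complex.Im x * complex.Im y.
Proof. by case: x; case: y. Qed.

Lemma ImM (x y : C) : complex.Im (x * y) =
  complex.Re x * complex.Im y + complex.Im x * complex.Re y.
Proof. by case: x; case: y. Qed.

Lemma ReD (x y : C) : complex.Re (x + y) = complex.Re x + complex.Re y.
Proof. by case: x; case: y. Qed.

Lemma ImD (x y : C) : complex.Im (x + y) = complex.Im x + complex.Im y.
Proof. by case: x; case: y. Qed.

Lemma Re_conj (x : C) : complex.Re (Num.conj x) = complex.Re x.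
Proof. by case: x. Qed.

Lemma Im_conj (x : C) : complex.Im (Num.conj x) = - complex.Im x.
Proof. by case: x. Qed.

Lemma Re_sum (I : Type) (r : seq I) (P : pred I) (F : I -> C) :
  complex.Re (\sum_(i <- r | P i) F i) = \sum_(i <- r | P i) complex.Re (F i).
Proof. exact: (big_morph _ ReD erefl). Qed.

Lemma Im_sum (I : Type) (r : seq I) (P : pred I) (F : I -> C) :
  complex.Im (\sum_(i <- r | P i) F i) = \sum_(i <- r | P i) complex.Im (F i).
Proof. exact: (big_morph _ ImD erefl). Qed.

Lemma adjM a b c (A : 'M[C]_(a, b)) (B : 'M[C]_(b, c)) :
  (A *m B) ^t* = B ^t* *m A ^t*.
Proof. by rewrite trmx_mul map_mxM. Qed.

Lemma adjD a b (A B : 'M[C]_(a, b)) : (A + B) ^t* = A ^t* + B ^t*.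
Proof. by rewrite linearD map_mxD. Qed.

Lemma adj1 a : (1%:M : 'M[C]_a) ^t* = 1%:M.
Proof. by rewrite trmx1 map_mx1. Qed.

Lemma adj_sum a b (I : Type) (r : seq I) (P : pred I) (F : I -> 'M[C]_(a, b)) :
  (\sum_(i <- r | P i) F i) ^t* = \sum_(i <- r | P i) (F i) ^t*.
Proof.
apply: (big_morph (fun A : 'M[C]_(a, b) => A ^t*)) => [A B|]; first exact: adjD.
by rewrite trmx0 map_mx0.
Qed.

Lemma adj_tens n k (A : 'M[C]_n) :
  (A *t (1%:M : 'M[C]_k)) ^t* = (A ^t*) *t 1%:M.
Proof. by rewrite trmx_tens map_mxT -/(1%:M ^t* : 'M[C]_k) adj1. Qed.

(** The Hilbert-Schmidt inner product, with matrices seen as a real Hilbert space: the integrands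
    are then real-valued, and Cauchy-Schwarz is a discriminant argument over [R]. *)
Definition ip a b (A B : 'M[C]_(a, b)) : R := complex.Re (\tr (A *m B ^t*)).

Definition nrm2 a b (A : 'M[C]_(a, b)) : R := ip A A.

Lemma ipE a b (A B : 'M[C]_(a, b)) : ip A B = \sum_i \sum_j
  (complex.Re (A i j) * complex.Re (B i j) + complex.Im (A i j) * complex.Im (B i j)).
Proof.
rewrite /ip /mxtrace Re_sum; apply: eq_bigr => i _.
rewrite mxE Re_sum; apply: eq_bigr => j _.
by rewrite !mxE ReM Re_conj Im_conj mulrN opprK.
Qed.

Lemma nrm2E a b (A : 'M[C]_(a, b)) : nrm2 A = \sum_i \sum_j
  (complex.Re (A i j) ^+ 2 + complex.Im (A i j) ^+ 2).
Proof. by rewrite /nrm2 ipE. Qed.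

Lemma ipC a b (A B : 'M[C]_(a, b)) : ip A B = ip B A.
Proof. by rewrite !ipE; do 2!apply: eq_bigr => ? _; rewrite mulrC [X in _ + X]mulrC. Qed.

Lemma ipDl a b (A B D : 'M[C]_(a, b)) : ip (A + B) D = ip A D + ip B D.
Proof. by rewrite /ip mulmxDl mxtraceD ReD. Qed.

Lemma ipDr a b (A B D : 'M[C]_(a, b)) : ip D (A + B) = ip D A + ip D B.
Proof. by rewrite ipC ipDl !(ipC D). Qed.

Lemma ipZl a b (r : R) (A D : 'M[C]_(a, b)) : ip (r%:C%C *: A) D = r * ip A D.
Proof. by rewrite /ip -scalemxAl mxtraceZ ReM /= mul0r subr0. Qed.

Lemma ipZr a b (r : R) (A D : 'M[C]_(a, b)) : ip D (r%:C%C *: A) = r * ip D A.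
Proof. by rewrite ipC ipZl ipC. Qed.

Lemma ip_suml a b (I : Type) (r : seq I) (P : pred I) (F : I -> 'M[C]_(a, b)) D :
  ip (\sum_(i <- r | P i) F i) D = \sum_(i <- r | P i) ip (F i) D.
Proof.
apply: (big_morph (fun A => ip A D)) => [A B|]; first exact: ipDl.
by rewrite /ip mul0mx mxtrace0.
Qed.

Lemma ip_sumr a b (I : Type) (r : seq I) (P : pred I) (F : I -> 'M[C]_(a, b)) D :
  ip D (\sum_(i <- r | P i) F i) = \sum_(i <- r | P i) ip D (F i).
Proof. by rewrite ipC ip_suml; apply: eq_bigr => i _; rewrite ipC. Qed.

Lemma ip_adj a b (A B : 'M[C]_(a, b)) : ip (A ^t*) (B ^t*) = ip A B.
Proof.
rewrite !ipE exchange_big; do 2!apply: eq_bigr => ? _.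
by rewrite !mxE !Re_conj !Im_conj mulrNN.
Qed.

Lemma ip_mulr a b c (A : 'M[C]_(a, b)) (B : 'M[C]_(b, c)) D :
  ip (A *m B) D = ip A (D *m B ^t*).
Proof. by rewrite /ip adjM trmxCK mulmxA. Qed.

Lemma ip_mull a b c (A : 'M[C]_(a, b)) (B : 'M[C]_(b, c)) D :
  ip (A *m B) D = ip B (A ^t* *m D).
Proof. by rewrite -ip_adj adjM ip_mulr -ip_adj !adjM !trmxCK. Qed.

Lemma nrm2_ge0 a b (A : 'M[C]_(a, b)) : 0 <= nrm2 A.
Proof. by rewrite nrm2E; do 2!apply: sumr_ge0 => ? _; rewrite addr_ge0 ?sqr_ge0. Qed.

Lemma nrm2_adj a b (A : 'M[C]_(a, b)) : nrm2 (A ^t*) = nrm2 A.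
Proof. exact: ip_adj. Qed.

Lemma nrm2_mulC a b (A : 'M[C]_(a, b)) : nrm2 (A ^t* *m A) = nrm2 (A *m A ^t*).
Proof. by rewrite /nrm2 [LHS]ip_mull [RHS]ip_mulr !trmxCK !mulmxA. Qed.

(** Cyclicity of the trace. It shows that each term in the expansion of |D|_2^2 is nonnegative,
    hence open to Tonelli. *)
Lemma ip_psd a b (A B : 'M[C]_(a, b)) :
  ip (A *m A ^t*) (B *m B ^t*) = nrm2 (A ^t* *m B).
Proof. by rewrite [RHS]ip_mull trmxCK ipC ip_mulr trmxCK mulmxA. Qed.

Lemma nrm2Z a b (r : R) (A : 'M[C]_(a, b)) : nrm2 (r%:C%C *: A) = r ^+ 2 * nrm2 A.
Proof. by rewrite /nrm2 ipZl ipZr mulrA. Qed.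

Lemma nrm2_linear a b (r : R) (A B : 'M[C]_(a, b)) :
  nrm2 (A + r%:C%C *: B) = nrm2 A + 2 * r * ip A B + r ^+ 2 * nrm2 B.
Proof.
rewrite /nrm2 ipDl !ipDr !ipZl !ipZr (ipC B A).
by move: (ip A A) (ip A B) (ip B B) => x y z; ring.
Qed.

Lemma ip_CauchySchwarz a b (A B : 'M[C]_(a, b)) : ip A B ^+ 2 <= nrm2 A * nrm2 B.
Proof.
have h r : 0 <= nrm2 A + 2 * r * ip A B + r ^+ 2 * nrm2 B.
  by rewrite -nrm2_linear nrm2_ge0.
have a0 := nrm2_ge0 A; have := nrm2_ge0 B; rewrite le_eqVlt => /predU1P[b0|b0].
  rewrite -b0 mulr0 expr2; have [->|x0] := eqVneq (ip A B) 0; first by rewrite mulr0.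
  (* When |B|_2 = 0 the quadratic form is affine in r, and this r gives it the value -1. *)
  have := h (- (nrm2 A + 1) / (2 * ip A B)).
  rewrite -b0 mulr0 addr0; move: x0; move: (nrm2 A) (ip A B) => x y y0.
  suff -> : 2 * (- (x + 1) / (2 * y)) * y = - (x + 1) by lra.
  by field.
have := h (- ip A B / nrm2 B); move: b0.
move: (nrm2 A) (ip A B) (nrm2 B) => x y z b0.
suff -> : x + 2 * (- y / z) * y + (- y / z) ^+ 2 * z = (x * z - y ^+ 2) / z.
  by rewrite pmulr_lge0 ?invr_gt0// subr_ge0.
by field; rewrite gt_eqF.
Qed.

(** Cauchy-Schwarz followed by the inequality of arithmetic and geometric means; the hypothesis is
    squared so that no root appears. *)
Lemma ip_le a b (A B : 'M[C]_(a, b)) (q x y : R) : 0 <= q -> 0 <= x -> 0 <= y ->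
  nrm2 A * nrm2 B <= q ^+ 2 * (x * y) -> 2 * ip A B <= q * (x + y).
Proof.
move=> q0 x0 y0 h.
have [ip0|ip0] := lerP (ip A B) 0.
  by apply: le_trans (_ : 0 <= _); [lra|rewrite mulr_ge0// addr_ge0].
rewrite -ler_sqr ?nnegrE ?mulr_ge0 ?addr_ge0//; last exact: ltW.
rewrite exprMn; have := ip_CauchySchwarz A B.
have : q ^+ 2 * (4 * (x * y)) <= q ^+ 2 * (x + y) ^+ 2.
  rewrite ler_wpM2l ?sqr_ge0//; have := sqr_ge0 (x - y); lra.
rewrite -exprMn; lra.
Qed.

(** This is [e] times |A - e^-1 B|_2^2 >= 0. The weight lets the dominant summand [A] keep a
    constant close to 1. *)
Lemma nrm2D_le a b (A B : 'M[C]_(a, b)) (e : R) : 0 < e ->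
  nrm2 (A + B) <= (1 + e) * nrm2 A + (1 + e^-1) * nrm2 B.
Proof.
move=> e0; have := nrm2_ge0 (A + (- e^-1)%:C%C *: B).
have := nrm2_linear 1 A B; rewrite scale1r => ->; rewrite nrm2_linear.
move: (nrm2 A) (ip A B) (nrm2 B) => x y z h.
have : 0 <= e * (x + 2 * - e^-1 * y + (- e^-1) ^+ 2 * z) by rewrite mulr_ge0// ltW.
have -> : e * (x + 2 * - e^-1 * y + (- e^-1) ^+ 2 * z) = e * x - 2 * y + e^-1 * z.
  by field; rewrite gt_eqF.
by move: (e^-1) => f; lra.
Qed.

Lemma nrm2_sum_le a b (I : Type) (r : seq I) (F : I -> 'M[C]_(a, b)) :
  nrm2 (\sum_(i <- r) F i) <= (size r)%:R * \sum_(i <- r) nrm2 (F i).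
Proof.
rewrite [X in X <= _]/nrm2 ip_suml.
under eq_bigr do rewrite ip_sumr.
have h i j : ip (F i) (F j) <= 2^-1 * (nrm2 (F i) + nrm2 (F j)).
  have := @ip_le _ _ (F i) (F j) 1 (nrm2 (F i)) (nrm2 (F j)) ler01.
  rewrite expr1n !mul1r => /(_ (nrm2_ge0 _) (nrm2_ge0 _) (lexx _)).
  by move: (ip _ _) (_ + _) => u v; lra.
apply: le_trans (_ : _ <= \sum_(i <- r) \sum_(j <- r) 2^-1 * (nrm2 (F i) + nrm2 (F j))) _.
  by do 2!apply: ler_sum => ? _.
under eq_bigr do rewrite -mulr_sumr big_split /= big_const_seq count_predT iter_addr_0.
rewrite -mulr_sumr big_split /= sumrMnl big_const_seq count_predT iter_addr_0.
by rewrite mulr_natl; set u := _ *+ size r; lra.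
Qed.

Lemma nrm2_row a b (A : 'M[C]_(a, b)) : nrm2 A = \sum_i nrm2 (row i A).
Proof.
rewrite nrm2E; apply: eq_bigr => i _; rewrite nrm2E big_ord1.
by apply: eq_bigr => j _; rewrite mxE.
Qed.

Lemma nrm2_col a b (A : 'M[C]_(a, b)) : nrm2 A = \sum_j nrm2 (col j A).
Proof.
rewrite nrm2E exchange_big; apply: eq_bigr => j _; rewrite nrm2E.
by apply: eq_bigr => i _; rewrite big_ord1 mxE.
Qed.

Lemma nrm2_Zc a b (z : C) (A : 'M[C]_(a, b)) :
  nrm2 (z *: A) = (complex.Re z ^+ 2 + complex.Im z ^+ 2) * nrm2 A.
Proof.
rewrite !nrm2E mulr_sumr; apply: eq_bigr => i _; rewrite mulr_sumr.
by apply: eq_bigr => j _; rewrite mxE ReM ImM; ring.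
Qed.

(* The unimodular phase of the product is absorbed by rescaling with its conjugate. *)
Lemma nrm2_rowcol a (u : 'rV[C]_a) (v : 'cV_a) : nrm2 (u *m v) <= nrm2 u * nrm2 v.
Proof.
pose z := (u *m v) 0 0; pose s := complex.Re z ^+ 2 + complex.Im z ^+ 2.
have s0 : 0 <= s by rewrite addr_ge0 ?sqr_ge0.
have -> : nrm2 (u *m v) = s by rewrite nrm2E !big_ord1.
have e : ip (Num.conj z *: u) (v ^t*) = s.
  rewrite /ip trmxCK -scalemxAl mxtraceZ trace_mx11 -/z ReM Re_conj Im_conj /s.
  by rewrite mulNr opprK.
have := ip_CauchySchwarz (Num.conj z *: u) (v ^t*).
rewrite e nrm2_Zc Re_conj Im_conj sqrrN -/s nrm2_adj -mulrA.
move: s0; rewrite le_eqVlt => /predU1P[<- _|s0].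
  by rewrite mulr_ge0 ?nrm2_ge0.
by rewrite expr2 ler_pM2l.
Qed.

Lemma nrm2M_le a b c (A : 'M[C]_(a, b)) (B : 'M[C]_(b, c)) :
  nrm2 (A *m B) <= nrm2 A * nrm2 B.
Proof.
rewrite (nrm2_row A) mulr_suml nrm2_row; apply: ler_sum => i _.
rewrite (nrm2_col B) mulr_sumr nrm2_col; apply: ler_sum => j _.
apply: le_trans (nrm2_rowcol _ _).
by rewrite row_mul !colE mulmxA.
Qed.

(* [|N K - K N|^2 >= 0] for Hermitian [N] and [K]. *)
Lemma nrm2_conj_le a (N K : 'M[C]_a) : N ^t* = N -> K ^t* = K ->
  ip (N *m K) (K *m N) <= nrm2 (N *m K).
Proof.
move=> hN hK; have := nrm2_ge0 (N *m K + (- 1)%:C%C *: (K *m N)).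
rewrite nrm2_linear (_ : nrm2 (K *m N) = nrm2 (N *m K)).
  by rewrite sqrrN expr1n; lra.
by rewrite -nrm2_adj adjM hN hK.
Qed.

Lemma nrm2_1 a : nrm2 (1%:M : 'M[C]_a) = a%:R.
Proof. by rewrite /nrm2 /ip adj1 mulmx1 mxtrace1 -(rmorph_nat (real_complex R)). Qed.

Lemma l2normE a (x : 'cV[C]_a) : l2norm x = Num.sqrt (nrm2 x).
Proof. by rewrite /l2norm nrm2E; congr Num.sqrt; apply: eq_bigr => i _; rewrite big_ord1. Qed.

Lemma opnorm_cV a (A : 'M[C]_a) (c : R) (x : 'cV_a) : 0 <= c -> opnorm A <= c ->
  nrm2 (A *m x) <= c ^+ 2 * nrm2 x.
Proof.
move=> c0 hA; have := nrm2_ge0 x; rewrite le_eqVlt => /predU1P[x0|x0].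
  by have := nrm2M_le A x; rewrite -x0 !mulr0.
pose s := Num.sqrt (nrm2 x).
have s0 : 0 < s by rewrite sqrtr_gt0.
have e : s ^+ 2 = nrm2 x by rewrite sqr_sqrtr ?nrm2_ge0.
have : l2norm (A *m (s^-1%:C%C *: x)) <= c.
  apply: le_trans hA; apply: sup_ubound.
    (* The supremum is an upper bound only for a set that is bounded above; on the unit ball the
       Hilbert-Schmidt norm of [A] is such a bound. *)
    exists (Num.sqrt (nrm2 A)) => _ /= [y hy <-]; move: hy; rewrite !l2normE => hy.
    rewrite ler_wsqrtr//; apply: le_trans (nrm2M_le _ _) _.
    rewrite ler_piMr ?nrm2_ge0//.
    by rewrite -(sqr_sqrtr (nrm2_ge0 y)) expr_le1 ?sqrtr_ge0.
  exists (s^-1%:C%C *: x) => //=.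
  by rewrite l2normE nrm2Z -e -exprMn mulVf ?gt_eqF// expr1n sqrtr1.
rewrite -scalemxAr l2normE nrm2Z sqrtrM ?sqr_ge0// sqrtr_sqr ger0_norm ?invr_ge0 ?(ltW s0)//.
rewrite ler_pdivrMl// -ler_sqr ?nnegrE ?sqrtr_ge0 ?mulr_ge0 ?(ltW s0)//.
by rewrite exprMn sqr_sqrtr ?nrm2_ge0// e mulrC.
Qed.

Lemma opnorm_mul a b (A : 'M[C]_a) (c : R) (X : 'M[C]_(a, b)) : 0 <= c -> opnorm A <= c ->
  nrm2 (A *m X) <= c ^+ 2 * nrm2 X.
Proof.
move=> c0 hA; rewrite (nrm2_col X) nrm2_col mulr_sumr; apply: ler_sum => j _.
by rewrite colE -mulmxA -colE; exact: opnorm_cV.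
Qed.

Lemma opnorm_form a b (A : 'M[C]_a) (c : R) (X : 'M[C]_(a, b)) : 0 <= c -> opnorm A <= c ->
  ip X (A *m X) <= c * nrm2 X.
Proof.
move=> c0 hA; have := @ip_le _ _ X (A *m X) c (nrm2 X) (nrm2 X) c0 (nrm2_ge0 _) (nrm2_ge0 _).
have h : nrm2 X * nrm2 (A *m X) <= c ^+ 2 * (nrm2 X * nrm2 X).
  by rewrite mulrCA ler_wpM2l ?nrm2_ge0// opnorm_mul.
by move/(_ h); lra.
Qed.

(** * Ampliation to the tensor product of C^n and C^k, and the partial trace *)

Section tensor.
Variables n k : nat.
Local Notation amp A := ((A : 'M[C]_n) *t (1%:M : 'M[C]_k)).

(** The partial trace over C^k, adjoint to the ampliation by [tr_amp]. It turns traces of size p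
    into linear functionals of an n by n matrix, to which the hypotheses on the law of G apply. *)
Definition ptr (B : 'M[C]_(n * k)) : 'M[C]_n :=
  \matrix_(i, j) \sum_l B (mxtens_index (i, l)) (mxtens_index (j, l)).

(** The columns whose second tensor coordinate is [l]. Right multiplication by an ampliation acts on
    each slice separately. *)
Definition cslice a (M : 'M[C]_(a, n * k)) (l : 'I_k) : 'M[C]_(a, n) :=
  \matrix_(i, j) M i (mxtens_index (j, l)).

Lemma sum_tens (V : nmodType) (F : 'I_(n * k) -> V) :
  \sum_i F i = \sum_(i < n) \sum_(l < k) F (mxtens_index (i, l)).
Proof.
rewrite pair_big /= (reindex (@mxtens_index n k)) //=; first by apply: eq_bigr => -[].
by exists (@mxtens_unindex n k) => x _; [exact: mxtens_indexK|exact: mxtens_unindexK].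
Qed.

Lemma amp1 : amp 1%:M = 1%:M.
Proof.
apply/matrixP => i j; case: (mxtens_indexP i) => i0 i1; case: (mxtens_indexP j) => j0 j1.
rewrite tensmxE !mxE -natrM mulnb; congr (nat_of_bool _)%:R.
by rewrite (can_eq (@mxtens_indexK n k)) xpair_eqE.
Qed.

Lemma ampM A B : amp A *m amp B = amp (A *m B).
Proof. by rewrite tensmx_mul mulmx1. Qed.

Lemma tr_amp B W : \tr (B *m amp W) = \tr (ptr B *m W).
Proof.
rewrite /mxtrace sum_tens; apply: eq_bigr => i _; rewrite mxE.
under eq_bigr do rewrite mxE sum_tens.
rewrite exchange_big /=; apply: eq_bigr => j _.
rewrite mxE mulr_suml; apply: eq_bigr => l _.
rewrite (bigD1 l) //= big1 ?addr0; first by rewrite tensmxE mxE eqxx mulr1.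
by move=> l' /negPf ll'; rewrite tensmxE [X in _ * (_ * X)]mxE ll' !mulr0.
Qed.

Lemma tr_ptr B : \tr (ptr B) = \tr B.
Proof. by rewrite -[ptr B]mulmx1 -tr_amp amp1 mulmx1. Qed.

Lemma ip_amp a (M N : 'M[C]_(a, n * k)) W :
  ip M (N *m amp W) = \sum_l ip (cslice M l) (cslice N l *m W).
Proof.
rewrite ipE /=; under [RHS]eq_bigr do rewrite ipE.
rewrite [RHS]exchange_big /=; apply: eq_bigr => i _.
rewrite sum_tens exchange_big /=; apply: eq_bigr => l _; apply: eq_bigr => j _.
suff -> : (N *m amp W) i (mxtens_index (j, l)) = (cslice N l *m W) i j by rewrite !mxE.
rewrite !mxE sum_tens; apply: eq_bigr => j' _.
rewrite (bigD1 l) //= big1 ?addr0; first by rewrite tensmxE !mxE eqxx mulr1.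
by move=> l' /negPf ll'; rewrite tensmxE [X in _ * (_ * X)]mxE ll' !mulr0.
Qed.

Lemma nrm2_cslice a (M : 'M[C]_(a, n * k)) : nrm2 M = \sum_l nrm2 (cslice M l).
Proof.
rewrite /nrm2 -[X in ip _ X]mulmx1 -amp1 ip_amp.
by apply: eq_bigr => l _; rewrite mulmx1.
Qed.

Lemma nrm2_amp_le a (M : 'M[C]_(a, n * k)) W : nrm2 (M *m amp W) <= nrm2 W * nrm2 M.
Proof.
rewrite {1}/nrm2 ip_mulr adj_tens -mulmxA ampM ip_amp (nrm2_cslice M) mulr_sumr.
apply: ler_sum => l _; rewrite mulmxA -ip_mulr mulrC; exact: nrm2M_le.
Qed.

(** Ampliation does not increase the operator norm; arguing slice by slice keeps the constant free
    of k. *)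
Lemma ip_amp_opnorm a (M : 'M[C]_(a, n * k)) W (c : R) : 0 <= c -> opnorm W <= c ->
  ip M (M *m amp W) <= c * nrm2 M.
Proof.
move=> c0 hW; rewrite ip_amp (nrm2_cslice M) mulr_sumr; apply: ler_sum => l _.
rewrite -ip_adj adjM -ip_mull ipC -(nrm2_adj (cslice M l)).
exact: opnorm_form.
Qed.

End tensor.

(** Cauchy-Schwarz of x x^* against the identity. It reduces E |G|_2^4 to the fourth-moment
    hypothesis. *)
Lemma sqr_nrm2_le n (x : 'M[C]_n) : nrm2 x ^+ 2 <= n%:R * nrm2 (x *m x ^t*).
Proof.
have := ip_CauchySchwarz (x *m x ^t*) 1%:M.
by rewrite nrm2_1 [ip _ 1%:M]/ip adj1 mulmx1 -/(ip x x) [nrm2 _ * _]mulrC.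
Qed.

Lemma nrm2_tr n (W : 'M[C]_n) (c : R) : 0 <= c -> opnorm W <= c ->
  complex.Re (\tr W) <= c * n%:R.
Proof.
move=> c0 /(opnorm_form 1%:M c0); rewrite mulmx1 nrm2_1 ipC /ip.
by rewrite adj1 mulmx1.
Qed.

End frobenius.

(** * Independence and Tonelli *)

Section independence.
Variable R : realType.
Local Open Scope ereal_scope.

Section tonelli.
Context d d' (T : measurableType d) (E : measurableType d').
Variables (P : probability T R) (X : {RV P >-> E}) (S : set (set T)).
Hypotheses (SI : setI_closed S) (ST : S setT) (Sm : S `<=` measurable).
Hypothesis XS : forall A B, S A -> measurable B ->
  P (X @^-1` B `&` A) = distribution P X B * P A.
Local Notation T' := (g_sigma_algebraType S).

Let sub_measurable (A : set T) : <<s S >> A -> measurable A.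
Proof. by move: A; apply: smallest_sub => //; exact: sigma_algebra_measurable. Qed.

Let sub_measurable_fun d2 (E2 : measurableType d2) (f : T' -> E2) :
  measurable_fun [set: T'] f -> measurable_fun [set: T] (f : T -> E2).
Proof.
move=> mf _ B mB; apply: sub_measurable; exact: (mf measurableT B mB).
Qed.

(** For fixed [B] both sides are finite measures in [A] that agree on the pi-system [S], hence on
    the sigma-algebra it generates. *)
Let indep_sigma (A : set T) B : <<s S >> A -> measurable B ->
  P (X @^-1` B `&` A) = distribution P X B * P A.
Proof.
move=> sA mB.
have mXB : measurable (X @^-1` B) by rewrite -[X in measurable X]setTI; exact: measurable_funPT.
have fX : distribution P X B \is a fin_num.
  by rewrite fin_num_measure.
have h0 : (0 <= fine (distribution P X B))%R by rewrite fine_ge0.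
have cover : \bigcup_(k : nat) [set: T] = setT.
  by apply/seteqP; split => // w _; exists 0%N.
pose m1 : {measure set T -> \bar R} := mrestr P mXB.
pose m2 : {measure set T -> \bar R} := mscale (NngNum h0) P.
have m2E C : m2 C = distribution P X B * P C by rewrite -(fineK fX).
rewrite setIC -m2E -/(m1 A).
apply: (@g_sigma_algebra_measure_unique _ R T S Sm (fun=> setT) (fun=> ST) cover m1 m2) => //.
- by move=> C SC; rewrite m2E -XS// setIC.
- by move=> k; rewrite /m1 /= /mrestr setTI (le_lt_trans (probability_le1 P mXB))// ltry.
Qed.

(** By independence the law of w |-> (X w, w) is the product of the law of [X] and of [P] restricted
    to the sigma-algebra generated by [S]; Tonelli then applies. Keeping the sample point itself as
    second coordinate spares the construction of a product probability space. *)
Lemma indep_tonelli (F : E * T' -> \bar R) : measurable_fun [set: E * T'] F ->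
  (forall z, 0 <= F z) ->
  measurable_fun [set: T] (fun w => \int[distribution P X]_x F (x, w)) /\
  \int[P]_w F (X w, w) = \int[P]_w \int[distribution P X]_x F (x, w).
Proof.
move=> mF F0.
have mid : measurable_fun [set: T] (fun w : T => w : T').
  by move=> _ A mA; rewrite setTI; exact: sub_measurable.
pose idm : {mfun T >-> T'} := HB.pack (fun w : T => w : T')
  (isMeasurableFun.Build _ _ _ _ _ mid).
have mphi : measurable_fun [set: T] (fun w : T => (X w, w) : E * T').
  by apply: measurable_fun_pair.
pose phi : {mfun T >-> (E * T')%type} := HB.pack (fun w : T => (X w, w) : E * T')
  (isMeasurableFun.Build _ _ _ _ _ mphi).
have mG : measurable_fun [set: T'] (fun w : T' => \int[distribution P X]_x F (x, w)).
  exact: measurable_fun_fubini_tonelli_G.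
split; first exact: sub_measurable_fun.
transitivity (\int[distribution P phi]_z F z).
  by rewrite ge0_integral_distribution.
transitivity (\int[distribution P X \x distribution P idm]_z F z).
  apply: eq_measure_integral => A mA _; apply/esym.
  apply: product_measure_unique => // B1 B2 mB1 mB2.
  exact: indep_sigma.
rewrite fubini_tonelli2// ge0_integral_distribution//.
by move=> w; apply: integral_ge0 => x _; exact: F0.
Qed.

Lemma indep_tonelli_le (F : E * T' -> \bar R) (h : T' -> \bar R) :
  measurable_fun [set: E * T'] F -> (forall z, 0 <= F z) -> measurable_fun [set: T'] h ->
  (forall w, \int[distribution P X]_x F (x, w) <= h w) ->
  \int[P]_w F (X w, w) <= \int[P]_w h w.
Proof.
move=> mF F0 mh le_h; have [mG ->] := indep_tonelli mF F0.
apply: ge0_le_integral => //; last exact: sub_measurable_fun.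
by move=> w _; apply: integral_ge0 => x _; exact: F0.
Qed.

End tonelli.

Section others.
Context d (T : measurableType d) (P : probability T R) (I : finType).
Variable F : I -> set (set T).
Hypotheses (FI : forall i, setI_closed (F i)) (FT : forall i, F i setT).
Hypotheses (Fm : forall i, F i `<=` measurable) (indF : mutually_independent P F).

(** A pi-system generating the sigma-algebra of all variables except the one at [s]. Intersecting
    over the whole index type, with the full space at [s], lets the product formula of mutual
    independence apply directly. *)
Definition others (s : I) : set (set T) := [set A | exists Bs : I -> set T,
  [/\ forall t, F t (Bs t), Bs s = setT & A = \bigcap_t Bs t]].

Lemma others_setI s : setI_closed (others s).
Proof.
move=> _ _ [B1 [FB1 B1s ->]] [B2 [FB2 B2s ->]].
exists (fun t => B1 t `&` B2 t); split; first by move=> t; exact: FI.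
- by rewrite B1s B2s setTI.
- by rewrite bigcapI.
Qed.

Lemma others_setT s : others s setT.
Proof. by exists (fun=> setT); split => //; rewrite bigcapT. Qed.

Lemma others_mem s t A : t != s -> F t A -> others s A.
Proof.
move=> ts FA; exists (fun u => if u == t then A else setT); split.
- by move=> u; case: eqP => [->|].
- by rewrite eq_sym (negPf ts).
- apply/seteqP; split => [w Aw u _|w /(_ t Logic.I)]; last by rewrite eqxx.
  by case: eqP.
Qed.

Let bigcap_prod (Bs : I -> set T) : (forall t, F t (Bs t)) ->
  P (\bigcap_t Bs t) = \prod_t P (Bs t).
Proof.
move=> FB; have := @indF [set: I]%SET Bs (fun t _ => FB t).
rewrite (_ : [set` [set: I]%SET] = [set: I]); last first.
  by apply/seteqP; split => // t _ /=; rewrite inE.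
by move=> ->; apply: eq_bigl => t; rewrite inE.
Qed.

Lemma others_measurable s : others s `<=` measurable.
Proof.
move=> _ [Bs [FB _ ->]]; apply: fin_bigcap_measurable => // t _.
exact/Fm/FB.
Qed.

Lemma others_indep s A B : others s A -> F s B -> P (B `&` A) = P B * P A.
Proof.
move=> [Bs [FB Bss ->]] FsB.
pose Bs' t := if t == s then B else Bs t.
have -> : B `&` \bigcap_t Bs t = \bigcap_t Bs' t.
  apply/seteqP; split => [w [Bw Bsw] t _|w h].
    by rewrite /Bs'; case: eqP => // _; exact: Bsw.
  split; first by have := h s Logic.I; rewrite /Bs' eqxx.
  by move=> t _; have := h t Logic.I; rewrite /Bs'; case: eqP => // ->; rewrite Bss.
rewrite !bigcap_prod//; last by move=> t; rewrite /Bs'; case: eqP => // ->.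
rewrite (bigD1 s)//= [in X in _ = _ * X](bigD1 s)//= Bss probability_setT mul1e.
rewrite {1}/Bs' eqxx; congr (_ * _); apply: eq_bigr => t ts.
by rewrite /Bs' (negPf ts).
Qed.

End others.

End independence.

(** * Measurable matrix-valued functions *)

Section measurable_matrices.
Variable R : realType.
Local Notation C := R[i].

(** Entrywise measurability: it makes sense for rectangular matrices too, whereas [cmx] equips only
    square ones with a sigma-algebra. *)
Definition mxmeas d (T : measurableType d) a b (M : T -> 'M[C]_(a, b)) : Prop :=
  forall i j, measurable_fun setT (fun w => complex.Re (M w i j)) /\
              measurable_fun setT (fun w => complex.Im (M w i j)).

Section closure.
Context d (T : measurableType d).

Lemma mxmeas_cst a b (A : 'M[C]_(a, b)) : mxmeas (fun _ : T => A).
Proof. by move=> i j; split; exact: measurable_cst. Qed.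

Lemma mxmeasM a b c (M : T -> 'M[C]_(a, b)) (N : T -> 'M[C]_(b, c)) :
  mxmeas M -> mxmeas N -> mxmeas (fun w => M w *m N w).
Proof.
move=> mM mN i j; split.
- under eq_fun do rewrite mxE Re_sum.
  apply: measurable_sum => k; under eq_fun do rewrite ReM.
  have [? ?] := mM i k; have [? ?] := mN k j.
  by apply: measurable_funB; exact: measurable_funM.
- under eq_fun do rewrite mxE Im_sum.
  apply: measurable_sum => k; under eq_fun do rewrite ImM.
  have [? ?] := mM i k; have [? ?] := mN k j.
  by apply: measurable_funD; exact: measurable_funM.
Qed.

Lemma mxmeasB a b (M N : T -> 'M[C]_(a, b)) :
  mxmeas M -> mxmeas N -> mxmeas (fun w => M w - N w).
Proof.
move=> mM mN i j; have [? ?] := mM i j; have [? ?] := mN i j; split.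
- have -> : (fun w => complex.Re ((M w - N w) i j)) =
    (fun w => complex.Re (M w i j) - complex.Re (N w i j)).
    by apply/funext => w; rewrite !mxE ReD; case: (N w i j).
  exact: measurable_funB.
- have -> : (fun w => complex.Im ((M w - N w) i j)) =
    (fun w => complex.Im (M w i j) - complex.Im (N w i j)).
    by apply/funext => w; rewrite !mxE ImD; case: (N w i j).
  exact: measurable_funB.
Qed.

Lemma mxmeas_sum a b (I : Type) (r : seq I) (P : pred I) (F : I -> T -> 'M[C]_(a, b)) :
  (forall i, mxmeas (F i)) -> mxmeas (fun w => \sum_(i <- r | P i) F i w).
Proof.
move=> mF i j; split.
- under eq_fun do rewrite summxE Re_sum big_mkcond.
  by apply: measurable_sum => k; case: (P k); [exact: (mF k i j).1|exact: measurable_cst].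
- under eq_fun do rewrite summxE Im_sum big_mkcond.
  by apply: measurable_sum => k; case: (P k); [exact: (mF k i j).2|exact: measurable_cst].
Qed.

Lemma mxmeas_adj a b (M : T -> 'M[C]_(a, b)) : mxmeas M -> mxmeas (fun w => (M w) ^t*).
Proof.
move=> mM i j; have [m1 m2] := mM j i; split.
- by under eq_fun do rewrite !mxE Re_conj.
- by under eq_fun do rewrite !mxE Im_conj; exact: measurableT_comp.
Qed.

Lemma mxmeas_scale a b (f : T -> R) (M : T -> 'M[C]_(a, b)) :
  measurable_fun setT f -> mxmeas M -> mxmeas (fun w => (f w)%:C%C *: M w).
Proof.
move=> mf mM i j; have [m1 m2] := mM i j; split.
- by under eq_fun do rewrite mxE ReM /= mul0r subr0; exact: measurable_funM.
- by under eq_fun do rewrite mxE ImM /= mul0r addr0; exact: measurable_funM.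
Qed.

Lemma mxmeas_amp n k (M : T -> 'M[C]_n) :
  mxmeas M -> mxmeas (fun w => M w *t (1%:M : 'M[C]_k)).
Proof.
move=> mM i j; have [m1 m2] := mM (mxtens_unindex i).1 (mxtens_unindex j).1.
set b := (mxtens_unindex i).2 == (mxtens_unindex j).2.
split.
- under eq_fun do rewrite mxE [X in _ * X]mxE ReM -/b.
  by case: b => /=; apply: measurable_funB; exact: measurable_funM.
- under eq_fun do rewrite mxE [X in _ * X]mxE ImM -/b.
  by case: b => /=; apply: measurable_funD; exact: measurable_funM.
Qed.

Lemma mxmeas_prod n (I : eqType) (r : seq I) (P : pred I) (F : I -> T -> 'M[C]_n) :
  (forall i, i \in r -> P i -> mxmeas (F i)) ->
  mxmeas (fun w => \prod_(i <- r | P i) F i w).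
Proof.
elim: r => [|i r ih] mF.
  by under eq_fun do rewrite big_nil; exact: mxmeas_cst.
under eq_fun do rewrite big_cons.
have {}ih : mxmeas (fun w => \prod_(i <- r | P i) F i w).
  by apply: ih => j jr; apply: mF; rewrite inE jr orbT.
by case: (boolP (P i)) => // Pi; apply: mxmeasM => //; apply: mF; rewrite ?mem_head.
Qed.

Lemma meas_ip a b (M N : T -> 'M[C]_(a, b)) :
  mxmeas M -> mxmeas N -> measurable_fun setT (fun w => ip (M w) (N w)).
Proof.
move=> mM mN; under eq_fun do rewrite ipE.
apply: measurable_sum => i; apply: measurable_sum => j.
have [? ?] := mM i j; have [? ?] := mN i j.
by apply: measurable_funD; exact: measurable_funM.
Qed.

Lemma meas_nrm2 a b (M : T -> 'M[C]_(a, b)) :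
  mxmeas M -> measurable_fun setT (fun w => nrm2 (M w)).
Proof. by move=> mM; exact: meas_ip. Qed.

End closure.

Lemma mxmeas_comp d d' (T : measurableType d) (T' : measurableType d') a b
    (M : T' -> 'M[C]_(a, b)) (f : T -> T') :
  mxmeas M -> measurable_fun setT f -> mxmeas (fun w => M (f w)).
Proof.
by move=> mM mf i j; split; [exact: (measurableT_comp (mM i j).1)|
  exact: (measurableT_comp (mM i j).2)].
Qed.

Lemma mxmeas_id n : mxmeas (fun x : cmx R n => (x : 'M[C]_n)).
Proof.
move=> i j; split=> _ B mB; rewrite setTI; apply: sub_sigma_algebra; exists i, j, B.
- by split=> //; left.
- by split=> //; right.
Qed.

Lemma measurable_cmx d (T : measurableType d) n (f : T -> cmx R n) :
  mxmeas (f : T -> 'M[C]_n) -> measurable_fun setT f.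
Proof.
move=> mf; apply: (@measurability _ _ T (cmx R n) setT f (@cmx_gen R n) erefl) => _ [_ [i [j [B [mB [->|->]]]]] <-].
- exact: (mf i j).1.
- exact: (mf i j).2.
Qed.

Section expectation.
Context d (T : measurableType d) (P : probability T R) (n : nat) (M : T -> 'M[C]_n).
Hypothesis iM : mx_integrable P M.

Let term (B : 'M[C]_n) (k : 'I_n * 'I_n) (x : T) : \bar R :=
  ((complex.Re (B k.1 k.2))%:E * (complex.Re (M x k.2 k.1))%:E +
   (- complex.Im (B k.1 k.2))%:E * (complex.Im (M x k.2 k.1))%:E)%E.

Let termE B x : (complex.Re (\tr (B *m M x)))%:E = (\sum_k term B k x)%E.
Proof.
rewrite /term; under eq_bigr do rewrite -!EFinM -EFinD.
rewrite sumEFin; congr EFin; rewrite /mxtrace Re_sum -(pair_big predT predT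
  (fun i j => complex.Re (B i j) * complex.Re (M x j i) +
    - complex.Im (B i j) * complex.Im (M x j i))) /=.
apply: eq_bigr => i _; rewrite mxE Re_sum; apply: eq_bigr => j _.
by rewrite ReM mulNr.
Qed.

Let term_int B k : P.-integrable setT (term B k).
Proof.
by apply: integrableD => //; apply: integrableZl => //; [exact: (iM _ _).1|exact: (iM _ _).2].
Qed.

Lemma integrable_retr (B : 'M[C]_n) :
  P.-integrable setT (fun x => (complex.Re (\tr (B *m M x)))%:E).
Proof.
under eq_fun do rewrite termE.
by apply: integrable_sum => // k _; exact: term_int.
Qed.

Lemma integral_retr (B : 'M[C]_n) :
  (\int[P]_x (complex.Re (\tr (B *m M x)))%:E = (complex.Re (\tr (B *m Emx P M)))%:E)%E.
Proof.
under eq_integral do rewrite termE.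
have ti := term_int B; rewrite integral_sum//.
rewrite /mxtrace Re_sum.
transitivity (\sum_(k : 'I_n * 'I_n) (complex.Re (B k.1 k.2 * Emx P M k.2 k.1))%:E)%E.
  apply: eq_bigr => -[i j] _ /=; rewrite /term /=.
  have [i1 i2] := iM j i.
  rewrite integralD//; do ?exact: integrableZl.
  rewrite !integralZl// ReM !mxE /= !unlock -mulNr EFinD !EFinM.
  by rewrite !fineK//; exact: integrable_fin_num.
rewrite sumEFin; congr EFin.
rewrite -(pair_big predT predT (fun i j => complex.Re (B i j * Emx P M j i))) /=.
by apply: eq_bigr => i _; rewrite mxE Re_sum.
Qed.

End expectation.

Lemma mx_integrable_bounded d (T : measurableType d) (P : probability T R) n
    (M : T -> 'M[C]_n) (K : R) :
  mxmeas M -> (forall x, nrm2 (M x) <= K) -> mx_integrable P M.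
Proof.
move=> mM hK i j.
have hle x : complex.Re (M x i j) ^+ 2 + complex.Im (M x i j) ^+ 2 <= K.
  apply: le_trans (hK x); rewrite nrm2E (bigD1 i)//= (bigD1 j)//= -addrA lerDl.
  by rewrite addr_ge0//; do ?[apply: sumr_ge0 => ? _]; rewrite addr_ge0 ?sqr_ge0.
(* The bound 1 + K avoids a square root: u^2 <= K gives 2|u| <= 1 + u^2 <= 1 + K. *)
have iK : P.-integrable setT (EFin \o cst (1 + K)) by exact: finite_measure_integrable_cst.
have sq (u v : R) : u ^+ 2 + v ^+ 2 <= K -> `|u| <= `|1 + K|.
  move=> h; rewrite [leRHS]ger0_norm; last by have := sqr_ge0 u; have := sqr_ge0 v; lra.
  have := sqr_ge0 v; have := sqr_ge0 (`|u| - 1); rewrite sqrrB1 real_normK ?num_real//.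
  have := sqr_ge0 u; have := normr_ge0 u; move: (`|u|) => t; lra.
have [m1 m2] := mM i j; split; apply: (le_integrable _ _ _ iK) => //.
- exact/measurable_EFinP.
- by move=> x _ /=; rewrite lee_fin; exact: sq (hle x).
- exact/measurable_EFinP.
- by move=> x _ /=; rewrite lee_fin; apply: sq; rewrite addrC; exact: hle.
Qed.

End measurable_matrices.

(** * Second moments of the Haar measure *)

Section haar.
Variable R : realType.
Local Notation C := R[i].

Lemma nrm2_eq0 a b (A : 'M[C]_(a, b)) : nrm2 A = 0 -> A = 0.
Proof.
rewrite nrm2E => /eqP; rewrite psumr_eq0 => [/allP h|i _]; last first.
  by apply: sumr_ge0 => j _; rewrite addr_ge0 ?sqr_ge0.
apply/matrixP => i j; rewrite mxE; have := h i (mem_index_enum _) => /=.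
rewrite psumr_eq0 => [/allP /(_ j (mem_index_enum _)) /=|k _]; last first.
  by rewrite addr_ge0 ?sqr_ge0.
rewrite paddr_eq0 ?sqr_ge0// !sqrf_eq0 => /andP[/eqP h1 /eqP h2].
by apply/eqP; rewrite eq_complex h1 h2 /= eqxx.
Qed.

(** Tested on the adjoint of M - N, the hypothesis says that |M - N|_2^2 = 0. *)
Lemma retr_inj n (M N : 'M[C]_n) :
  (forall B, complex.Re (\tr (B *m M)) = complex.Re (\tr (B *m N))) -> M = N.
Proof.
move=> h; apply/eqP; rewrite -subr_eq0; apply/eqP/nrm2_eq0.
rewrite /nrm2 /ip mxtrace_mulC mulmxBr linearB /= ReD h.
by rewrite -ReD subrr.
Qed.

Definition uind p (x : 'M[C]_p) : R := (x \is unitarymx)%:R.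

(* Haar measure lives on M_p(C) and charges only U(p): cutting off to 0 outside
   U(p), rather than to some unitary, keeps equivariance under translations. *)
Definition upart p (x : 'M[C]_p) : 'M[C]_p := (uind x)%:C%C *: x.

Section upart.
Variable p : nat.
Implicit Types x U : 'M[C]_p.

Lemma upart_unitary x : x \is unitarymx -> upart x = x.
Proof. by rewrite /upart /uind => ->; rewrite scale1r. Qed.

Lemma upart_unitaryP x : (x \is unitarymx /\ upart x = x /\ uind x = 1) \/
  (upart x = 0 /\ uind x = 0).
Proof.
rewrite /upart /uind; case: (boolP (x \is unitarymx)) => h /=.
  by left; rewrite scale1r.
by right; rewrite scale0r.
Qed.

Lemma uind_ge0 x : 0 <= uind x.
Proof. by rewrite /uind ler0n. Qed.

Lemma uind_le1 x : uind x <= 1.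
Proof. by rewrite /uind lern1 leq_b1. Qed.

Lemma upart_mul_adj x : upart x *m (upart x) ^t* = (uind x)%:C%C%:M.
Proof.
case: (upart_unitaryP x) => [[/unitarymxP h [-> ->]]|[-> ->]]; first by rewrite h.
by rewrite mul0mx rmorph0.
Qed.

Lemma upart_adj_mul x : (upart x) ^t* *m upart x = (uind x)%:C%C%:M.
Proof.
case: (upart_unitaryP x) => [[h [-> ->]]|[-> ->]]; last by rewrite mulmx0 rmorph0.
by move: h; rewrite -trmxC_unitary => /unitarymxP; rewrite trmxCK => ->.
Qed.

Lemma upart_mull U x : U \is unitarymx -> upart (U *m x) = U *m upart x.
Proof.
move=> uU; have UU : U *m U ^t* = 1%:M by apply/unitarymxP.
have VV : U ^t* *m U = 1%:M.
  by move: uU; rewrite -trmxC_unitary => /unitarymxP; rewrite trmxCK.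
suff e : (U *m x \is unitarymx) = (x \is unitarymx).
  by rewrite /upart /uind e scalemxAr.
apply/unitarymxP/unitarymxP; rewrite adjM => h; last first.
  by rewrite mulmxA -(mulmxA U) h mulmx1 UU.
have : U ^t* *m (U *m x *m (x ^t* *m U ^t*)) *m U = 1%:M by rewrite h mulmx1 VV.
by rewrite !mulmxA VV mul1mx -!mulmxA VV mulmx1.
Qed.

Lemma nrm2_mul_upart a (M : 'M[C]_(a, p)) x : nrm2 (M *m upart x) = uind x * nrm2 M.
Proof. by rewrite /nrm2 ip_mulr -mulmxA upart_mul_adj mul_mx_scalar ipZr. Qed.

Lemma nrm2_mul_upart_adj a (M : 'M[C]_(a, p)) x :
  nrm2 (M *m (upart x) ^t*) = uind x * nrm2 M.
Proof. by rewrite /nrm2 ip_mulr trmxCK -mulmxA upart_adj_mul mul_mx_scalar ipZr. Qed.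

Lemma measurable_unitary : measurable [set x : cmx R p | (x : 'M[C]_p) \is unitarymx].
Proof.
have mf : measurable_fun setT (fun x : cmx R p => nrm2 ((x : 'M[C]_p) *m x ^t* - 1%:M)).
  apply: meas_nrm2; apply: mxmeasB; last exact: mxmeas_cst.
  by apply: mxmeasM; [|apply: mxmeas_adj]; exact: mxmeas_id.
have := mf measurableT _ (measurable_set1 (0 : R)).
rewrite setTI; congr (measurable _); apply/seteqP; split => x /=.
  by move/nrm2_eq0/eqP; rewrite subr_eq0 => h; apply/unitarymxP/eqP.
move/unitarymxP => ->; rewrite subrr nrm2E big1// => i _; rewrite big1// => j _.
by rewrite mxE /= expr0n addr0.
Qed.

Lemma mxmeas_upart : mxmeas (fun x : cmx R p => upart x).
Proof.
apply: mxmeas_scale; last exact: mxmeas_id.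
have := @measurable_indic _ _ R setT _ measurable_unitary.
congr measurable_fun; apply/funext => x; rewrite indicE /uind; congr (nat_of_bool _)%:R.
by apply/idP/idP => [/set_mem //|h]; apply: mem_set.
Qed.

End upart.

Lemma tr_conj n (B U X : 'M[C]_n) :
  \tr (B *m (U *m X *m U ^t*)) = \tr (U ^t* *m B *m U *m X).
Proof. by rewrite mulmxA mxtrace_mulC !mulmxA. Qed.

(** Tested against the functionals Re tr (B .), this is the change of variables by [lU], which
    preserves [mu]. *)
Lemma Emx_conj d (T : measurableType d) n (mu : probability T R) (lU : T -> T)
    (F : T -> 'M[C]_n) (U : 'M[C]_n) :
  measurable_fun setT lU -> (forall A, measurable A -> mu (lU @^-1` A) = mu A) ->
  mx_integrable mu F -> (forall x, F (lU x) = U *m F x *m U ^t*) ->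
  Emx mu F = U *m Emx mu F *m U ^t*.
Proof.
move=> mL inv iF FU; apply: retr_inj => B; apply/EFin_inj.
rewrite tr_conj -(integral_retr iF B) -(integral_retr iF (U ^t* *m B *m U)).
pose g x : \bar R := (complex.Re (\tr (B *m F x)))%:E.
have gE : g \o lU = fun x => (complex.Re (\tr (U ^t* *m B *m U *m F x)))%:E.
  by apply/funext => x; rewrite /g /= FU tr_conj.
transitivity (\int[pushforward mu lU]_x g x)%E.
  by apply: eq_measure_integral => A mA _; apply/esym; exact: inv.
have mg : measurable_fun setT g by exact: (measurable_int mu (integrable_retr iF B)).
have ig : mu.-integrable setT (g \o lU) by rewrite gE; exact: integrable_retr.
have := integral_pushforward mL mg ig measurableT; rewrite preimage_setT gE => ->.
by [].
Qed.

Section haar_second_moment.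
Variables (p n : nat) (mu : probability (cmx R p) R).
Hypotheses (p0 : (0 < p)%N) (hmu : haar_unitary mu).
Variables (L W : 'M[C]_(p, n)).

Let F (x : cmx R p) : 'M[C]_p := upart x *m (W *m W ^t*) *m (upart x) ^t*.

Let mF : mxmeas F.
Proof.
apply: mxmeasM; last by apply: mxmeas_adj; exact: mxmeas_upart.
by apply: mxmeasM; [exact: mxmeas_upart|exact: mxmeas_cst].
Qed.

Let iF : mx_integrable mu F.
Proof.
apply: (@mx_integrable_bounded _ _ _ _ _ _ (nrm2 (W *m W ^t*))) => // x.
rewrite /F nrm2_mul_upart_adj.
have := uind_ge0 x; have := uind_le1 x => u1 u0.
apply: le_trans (_ : nrm2 (upart x *m (W *m W ^t*)) <= _).
  by rewrite ler_piMl ?nrm2_ge0.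
by rewrite -nrm2_adj !adjM trmxCK nrm2_mul_upart_adj ler_piMl ?nrm2_ge0.
Qed.

Let Phi := Emx mu F.

Let Phi_conj U : U \is unitarymx -> Phi = U *m Phi *m U ^t*.
Proof.
move=> uU; apply: (@Emx_conj _ _ _ mu (fun x => U *m x)) => //.
- by apply: measurable_cmx; apply: mxmeasM; [exact: mxmeas_cst|exact: mxmeas_id].
- by move=> A mA; exact: (hmu.2 U A uU mA).1.
- move=> x; rewrite /F (upart_mull _ uU) adjM; move: (upart _) (_ *m W ^t*) => Y Z.
  by rewrite !mulmxA.
Qed.

Let sgn (a : 'I_p) : 'M[C]_p := diag_mx (\row_j (-1) ^+ (j == a)).

Let sgn_unitary a : sgn a \is unitarymx.
Proof.
apply/unitarymxP; rewrite /sgn tr_diag_mx map_diag_mx mulmx_diag.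
apply/matrixP => i j; rewrite !mxE; congr (_ *+ _).
by rewrite rmorphXn rmorphN1 -exprMn mulrNN mulr1 expr1n.
Qed.

Let perm_unitary (s : {perm 'I_p}) : (perm_mx s : 'M[C]_p) \is unitarymx.
Proof.
by apply/unitarymxP; rewrite tr_perm_mx map_perm_mx -perm_mxM fingroup.mulgV perm_mx1.
Qed.

(** Schur's lemma by hand. Conjugation by a diagonal sign matrix with a single -1 at [i] negates the
    entry (i, j), which must then vanish; conjugation by a transposition equates two diagonal
    entries. *)
Let Phi_scalar (i0 : 'I_p) : Phi = (Phi i0 i0)%:M.
Proof.
apply/matrixP => i j; rewrite [RHS]mxE.
have [<-|ij] := eqVneq i j.
  have := Phi_conj (perm_unitary (tperm i i0)) => /matrixP /(_ i i) ->.
  have -> : (perm_mx (tperm i i0) : 'M[C]_p) ^t* = perm_mx (tperm i i0)^-1.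
    by rewrite tr_perm_mx map_perm_mx.
  by rewrite -row_permE -col_permE !mxE !tpermL mulr1n.
have := Phi_conj (sgn_unitary i) => /matrixP /(_ i j).
rewrite /sgn tr_diag_mx map_diag_mx mul_diag_mx mul_mx_diag !mxE eqxx eq_sym (negPf ij).
rewrite expr1 expr0 rmorph1 mulr1 mulN1r => h.
by move/eqP: h; rewrite -addr_eq0 -mulr2n mulrn_eq0 /= => /eqP ->; rewrite mulr0n.
Qed.

(** [Phi] is a scalar matrix whose trace is at most |W|_2^2, since [upart x] either preserves norms
    or is zero; so the scalar is at most |W|_2^2 / p. The integral is its product with |L|_2^2. *)
Lemma haar_nrm2_le : (\int[mu]_x (nrm2 (L ^t* *m upart x *m W))%:E <=
  (p%:R^-1 * (nrm2 L * nrm2 W))%:E)%E.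
Proof.
pose i0 := Ordinal p0; pose l := complex.Re (Phi i0 i0).
(* The scalar in [Phi] is a complex number; a real trace of [B] removes its imaginary part from the
   product. *)
have trP (B : 'M[C]_p) : complex.Im (\tr B) = 0 ->
    complex.Re (\tr (B *m Phi)) = l * complex.Re (\tr B).
  by move=> B0; rewrite (Phi_scalar i0) mul_mx_scalar mxtraceZ ReM B0 mulr0 subr0.
have Im_tr (Y : 'M[C]_(p, n)) : complex.Im (\tr (Y *m Y ^t*)) = 0.
  rewrite /mxtrace Im_sum big1// => i _; rewrite mxE Im_sum big1// => j _.
  by rewrite !mxE ImM Re_conj Im_conj mulrN mulrC addNr.
have FE x : F x = (upart x *m W) *m (upart x *m W) ^t*.
  by rewrite /F adjM !mulmxA.
have lp : l * p%:R <= nrm2 W.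
  have := trP 1%:M; rewrite mul1mx mxtrace1 -(rmorph_nat (real_complex R)) /= => <- //.
  rewrite -lee_fin -[Phi]mul1mx -(integral_retr iF 1%:M).
  have F1 x : complex.Re (\tr (1%:M *m F x)) = uind x * nrm2 W.
    rewrite mul1mx FE -/(ip _ _) -/(nrm2 _) -nrm2_adj adjM nrm2_mul_upart_adj.
    by rewrite nrm2_adj.
  apply: le_trans (_ : (\int[mu]_x (cst (nrm2 W)%:E x) <= _)%E).
    apply: ge0_le_integral => //.
    - by move=> x _; rewrite lee_fin F1 mulr_ge0 ?uind_ge0 ?nrm2_ge0.
    - exact: (measurable_int mu (integrable_retr iF 1%:M)).
    - by move=> x _; rewrite lee_fin F1 ler_piMl ?uind_le1 ?nrm2_ge0.
  rewrite integral_cst//. rewrite -[leRHS]mule1.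
  by apply: lee_wpmul2l; [rewrite lee_fin nrm2_ge0|exact: probability_le1].
have -> : (\int[mu]_x (nrm2 (L ^t* *m upart x *m W))%:E =
          \int[mu]_x (complex.Re (\tr (L *m L ^t* *m F x)))%:E)%E.
  apply: eq_integral => x _; congr (complex.Re _)%:E; rewrite FE -mulmxA.
  move: (upart x *m W) => Y; rewrite adjM trmxCK -!mulmxA [RHS]mxtrace_mulC.
  by rewrite -!mulmxA.
rewrite (integral_retr iF) trP// lee_fin -/(ip L L) -/(nrm2 L).
rewrite mulrCA [leLHS]mulrC ler_wpM2l ?nrm2_ge0//.
by rewrite ler_pdivlMl ?ltr0n// [leLHS]mulrC.
Qed.

End haar_second_moment.

End haar.

(** * The words in the random matrices *)

Section model.
Variables (R : realType) (m n k : nat).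
Local Notation C := R[i].
Local Notation p := (n * k)%N.
Variables (calG : probability (cmx R n) R) (c2 : R).
Hypotheses (c20 : 0 <= c2).
Hypothesis hG2_int : mx_integrable calG (fun M : 'M[C]_n => M *m M ^t*).
Hypothesis hG2 : Emx calG (fun M : 'M[C]_n => M *m M ^t*) = 1%:M.
Hypothesis hG4_int : mx_integrable calG (fun M : 'M[C]_n => (M *m M ^t*) ^+ 2).
Hypothesis hG4 : opnorm (Emx calG (fun M : 'M[C]_n => (M *m M ^t*) ^+ 2)) <= c2.
Context (disp : measure_display) (T : measurableType disp) (P : probability T R).
Variables (G : 'I_m -> {RV P >-> cmx R n}) (H : 'I_m -> {RV P >-> cmx R p}).
Hypothesis hG : forall i, has_distribution (G i) calG.
Hypothesis hH : forall i, haar_unitary (distribution P (H i)).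
Hypothesis hindep : independent_GH G H.

Definition GH_sigma (s : 'I_m + 'I_m) : set (set T) := match s with
  | inl i => g_sigma_algebra_preimage (G i)
  | inr i => g_sigma_algebra_preimage (H i)
  end.

Lemma preimage_setI_closed d (E : measurableType d) (f : T -> E) :
  setI_closed (g_sigma_algebra_preimage f).
Proof.
move=> _ _ [A mA <-] [B mB <-]; exists (A `&` B); first exact: measurableI.
by rewrite !setTI preimage_setI.
Qed.

Lemma preimage_setT_mem d (E : measurableType d) (f : T -> E) :
  g_sigma_algebra_preimage f setT.
Proof. by exists setT => //; rewrite setTI preimage_setT. Qed.

Lemma GH_setI s : setI_closed (GH_sigma s).
Proof. by case: s => i; exact: preimage_setI_closed. Qed.

Lemma GH_setT s : GH_sigma s setT.
Proof. by case: s => i; exact: preimage_setT_mem. Qed.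

Lemma GH_measurable s : GH_sigma s `<=` measurable.
Proof. by case: s => i _ [A mA <-]; exact: measurable_funPT. Qed.

(* [T] itself, but with the sigma-algebra generated by all the variables except the
   one indexed by [s]. *)
Definition rest s := g_sigma_algebraType (others GH_sigma s).

Lemma rest_meas d (E : measurableType d) s t (f : T -> E) : t != s ->
  g_sigma_algebra_preimage f `<=` GH_sigma t ->
  measurable_fun [set: rest s] (f : rest s -> E).
Proof.
move=> ts sub _ B mB; rewrite setTI; apply: sub_sigma_algebra.
apply: (others_mem GH_setT ts); apply: sub.
by exists B => //; rewrite setTI.
Qed.

Lemma rest_G s j : inl j != s -> mxmeas (fun w : rest s => (G j w : 'M[C]_n)).
Proof.
move=> js; apply: (mxmeas_comp (@mxmeas_id R n)).
exact: (rest_meas js).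
Qed.

Lemma rest_H s j : inr j != s -> mxmeas (fun w : rest s => upart (H j w)).
Proof.
move=> js; apply: (mxmeas_comp (@mxmeas_upart R p)).
exact: (rest_meas js).
Qed.

Local Notation I f := (\int[P]_w (f w)%:E)%E.

(** * Integrating out one random matrix, the others being fixed *)

Lemma tonelli_G l (F : cmx R n -> T -> R) (h : T -> R) :
  measurable_fun [set: cmx R n * rest (inl l)] (fun z => F z.1 z.2) ->
  (forall x w, 0 <= F x w) -> measurable_fun [set: rest (inl l)] h ->
  (forall w, (\int[calG]_x (F x w)%:E <= (h w)%:E)%E) ->
  (I (fun w => F (G l w) w) <= I h)%E.
Proof.
move=> mF F0 mh le_h.
have XS A B : others GH_sigma (inl l) A -> measurable B ->
    P (G l @^-1` B `&` A) = (distribution P (G l) B * P A)%E.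
  move=> oA mB; apply: (others_indep hindep oA).
  by exists B => //; rewrite setTI.
have := @indep_tonelli_le R _ _ T _ P (G l) _ (others_setI GH_setI (s := inl l))
  (others_setT GH_setT (inl l)) (others_measurable GH_measurable (s := inl l)) XS
  (fun z => (F z.1 z.2)%:E) (fun w => (h w)%:E).
apply.
- exact/measurable_EFinP.
- by move=> z; rewrite lee_fin.
- exact/measurable_EFinP.
- move=> w; apply: le_trans (le_h w) => /=.
  by rewrite (eq_measure_integral calG)// => A mA _; exact: hG.
Qed.

Lemma tonelli_H l (F : cmx R p -> T -> R) (h : T -> R) :
  measurable_fun [set: cmx R p * rest (inr l)] (fun z => F z.1 z.2) ->
  (forall x w, 0 <= F x w) -> measurable_fun [set: rest (inr l)] h ->
  (forall w, (\int[distribution P (H l)]_x (F x w)%:E <= (h w)%:E)%E) ->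
  (I (fun w => F (H l w) w) <= I h)%E.
Proof.
move=> mF F0 mh le_h.
have XS A B : others GH_sigma (inr l) A -> measurable B ->
    P (H l @^-1` B `&` A) = (distribution P (H l) B * P A)%E.
  move=> oA mB; apply: (others_indep hindep oA).
  by exists B => //; rewrite setTI.
have := @indep_tonelli_le R _ _ T _ P (H l) _ (others_setI GH_setI (s := inr l))
  (others_setT GH_setT (inr l)) (others_measurable GH_measurable (s := inr l)) XS
  (fun z => (F z.1 z.2)%:E) (fun w => (h w)%:E).
apply => //.
- exact/measurable_EFinP.
- by move=> z; rewrite lee_fin.
- exact/measurable_EFinP.
Qed.

Lemma rest_sub d (E : measurableType d) s (f : T -> E) :
  measurable_fun [set: rest s] (f : rest s -> E) -> measurable_fun [set: T] f.
Proof.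
move=> mf _ B mB; have := mf measurableT B mB; rewrite !setTI.
move: (f @^-1` B); apply: smallest_sub; first exact: sigma_algebra_measurable.
exact: (others_measurable GH_measurable).
Qed.

Lemma mxmeas_rest_sub a b s (M : T -> 'M[C]_(a, b)) :
  mxmeas (M : rest s -> _) -> mxmeas M.
Proof. by move=> mM i j; split; apply: (@rest_sub _ _ s); [exact: (mM i j).1|exact: (mM i j).2]. Qed.

Lemma mxmeas_G j : mxmeas (fun w : T => (G j w : 'M[C]_n)).
Proof. by apply: (mxmeas_comp (@mxmeas_id R n)); exact: measurable_funPT. Qed.

Lemma mxmeas_H j : mxmeas (fun w : T => upart (H j w)).
Proof. by apply: (mxmeas_comp (@mxmeas_upart R p)); exact: measurable_funPT. Qed.

Local Notation amp A := ((A : 'M[C]_n) *t (1%:M : 'M[C]_k)).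

(** It differs from G_l H_l only where [H l] fails to be unitary, a null event. There it is zero, so
    norm bounds on words hold pointwise and not just almost everywhere. *)
Definition xi l w : 'M[C]_p := amp (G l w) *m upart (H l w).

Lemma mxmeas_xi l : mxmeas (xi l).
Proof.
by apply: mxmeasM; [apply: mxmeas_amp; exact: mxmeas_G|exact: mxmeas_H].
Qed.

Lemma le_I (f g : T -> R) : (forall w, 0 <= f w) -> measurable_fun setT f ->
  measurable_fun setT g -> (forall w, f w <= g w) -> (I f <= I g)%E.
Proof.
move=> f0 mf mg fg; apply: ge0_le_integral => //.
- by move=> w _; rewrite lee_fin.
- exact/measurable_EFinP.
- exact/measurable_EFinP.
- by move=> w _; rewrite lee_fin.
Qed.

(** Exhibits the integrand as a linear functional of x x^*, so that its mean over G is read off from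
    E G G^* = I. *)
Lemma nrm2_amp_psd a b (Y : 'M[C]_(a, p)) (Z : 'M[C]_(a, b)) (x : 'M[C]_n) :
  nrm2 ((Y *m amp x) ^t* *m Z) =
  complex.Re (\tr (ptr ((Z ^t* *m Y) ^t* *m (Z ^t* *m Y)) *m (x *m x ^t*))).
Proof.
have -> : nrm2 ((Y *m amp x) ^t* *m Z) = nrm2 (Z ^t* *m Y *m amp x).
  by rewrite -nrm2_adj (adjM (_ ^t*)) trmxCK mulmxA.
rewrite -tr_amp -ampM -adj_tens /nrm2 /ip; congr complex.Re; move: (Z ^t* *m Y) (amp x) => M K.
by rewrite adjM !mulmxA [LHS]mxtrace_mulC !mulmxA.
Qed.

(** The factor [upart u] cancels against its adjoint, up to a scalar at most 1. With N = Y^* Y and K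
    the ampliation of x x^*, what remains is tr (N K N K), where the two copies of K are apart.
    [nrm2_conj_le] brings them together: |N K|_2^2 is linear in K^2, whose mean is controlled. *)
Lemma nrm2_conj_amp_le a (Y : 'M[C]_(a, p)) (x : 'M[C]_n) (u : 'M[C]_p) :
  nrm2 ((Y *m (amp x *m upart u)) ^t* *m (Y *m (amp x *m upart u))) <=
  nrm2 (Y ^t* *m Y *m amp (x *m x ^t*)).
Proof.
rewrite nrm2_mulC mulmxA adjM -mulmxA (mulmxA (upart u)) upart_mul_adj.
rewrite mul_scalar_mx -scalemxAr nrm2Z.
apply: le_trans (_ : nrm2 (Y *m amp x *m (Y *m amp x) ^t*) <= _).
  rewrite ler_piMl ?nrm2_ge0// expr_le1 ?uind_ge0 ?uind_le1//.
rewrite -ampM -adj_tens; move: (amp x) => K.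
have hN : (Y ^t* *m Y) ^t* = Y ^t* *m Y by rewrite adjM trmxCK.
have hK : (K *m K ^t*) ^t* = K *m K ^t* by rewrite adjM trmxCK.
apply: le_trans (nrm2_conj_le hN hK); rewrite le_eqVlt; apply/orP; left; apply/eqP.
rewrite /nrm2 /ip !adjM !trmxCK; congr complex.Re.
by rewrite -!mulmxA [RHS]mxtrace_mulC -!mulmxA.
Qed.

Lemma nrm2_amp4 (N : 'M[C]_p) (x : 'M[C]_n) :
  nrm2 (N *m amp (x *m x ^t*)) =
  complex.Re (\tr (ptr (N ^t* *m N) *m (x *m x ^t*) ^+ 2)).
Proof.
have : (x *m x ^t*) ^t* = x *m x ^t* by rewrite adjM trmxCK.
move: (x *m x ^t*) => y hy; have -> : y ^+ 2 = y *m y by rewrite expr2.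
rewrite -tr_amp -ampM; have := adj_tens k y; rewrite hy; move: (amp y) => K hK.
rewrite /nrm2 /ip (adjM N) hK; congr complex.Re.
by rewrite !mulmxA [LHS]mxtrace_mulC !mulmxA.
Qed.

Lemma nrm2_upart_le a b (Y : 'M[C]_(a, p)) (Z : 'M[C]_(a, b)) (K u : 'M[C]_p) :
  nrm2 ((Y *m (K *m upart u)) ^t* *m Z) <= nrm2 ((Y *m K) ^t* *m Z).
Proof.
have e (M : 'M[C]_(a, p)) : nrm2 (M ^t* *m Z) = nrm2 (Z ^t* *m M).
  by rewrite -nrm2_adj (adjM (_ ^t*)) trmxCK.
rewrite !e !mulmxA; move: (Z ^t* *m Y *m K) => M.
by rewrite nrm2_mul_upart ler_piMl ?nrm2_ge0 ?uind_le1.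
Qed.

(** The last letter of the first word stands next to its own adjoint in the trace, so averaging over
    G_l replaces it by the identity. A letter that occurs in only one of the two words is thus
    removed at no cost. *)
Lemma step_mean l b (Y : T -> 'M[C]_(b, p)) c (Z : T -> 'M[C]_(b, c)) :
  mxmeas (Y : rest (inl l) -> _) -> mxmeas (Z : rest (inl l) -> _) ->
  (I (fun w => nrm2 ((Y w *m xi l w) ^t* *m Z w)) <=
   I (fun w => nrm2 ((Y w) ^t* *m Z w)))%E.
Proof.
move=> mY mZ; have mY' := mxmeas_rest_sub mY; have mZ' := mxmeas_rest_sub mZ.
pose F (x : cmx R n) w := nrm2 ((Y w *m amp x) ^t* *m Z w).
apply: (@le_trans _ _ (I (fun w => F (G l w) w))).
  apply: le_I => [w|||w]; first exact: nrm2_ge0.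
  - apply: meas_nrm2; apply: mxmeasM => //; apply: mxmeas_adj; apply: mxmeasM => //.
    exact: mxmeas_xi.
  - apply: meas_nrm2; apply: mxmeasM => //; apply: mxmeas_adj; apply: mxmeasM => //.
    exact/mxmeas_amp/mxmeas_G.
  - exact: nrm2_upart_le.
apply: tonelli_G => [|||w].
- apply: meas_nrm2; apply: mxmeasM.
    apply: mxmeas_adj; apply: mxmeasM.
      exact: (mxmeas_comp mY measurable_snd).
    apply: mxmeas_amp; exact: (mxmeas_comp (@mxmeas_id R n) measurable_fst).
  exact: (mxmeas_comp mZ measurable_snd).
- by move=> x w; exact: nrm2_ge0.
- by apply: meas_nrm2; apply: mxmeasM => //; exact: mxmeas_adj.
- under eq_integral do rewrite /F nrm2_amp_psd.
  rewrite (integral_retr hG2_int) hG2 mulmx1 tr_ptr lee_fin.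
  have -> : (Y w) ^t* *m Z w = ((Z w) ^t* *m Y w) ^t* by rewrite adjM trmxCK.
  by move: ((Z w) ^t* *m Y w) => M; rewrite /nrm2 /ip trmxCK.
Qed.

Lemma step_mean_sym l b (Y : T -> 'M[C]_(b, p)) c (Z : T -> 'M[C]_(b, c)) :
  mxmeas (Y : rest (inl l) -> _) -> mxmeas (Z : rest (inl l) -> _) ->
  (I (fun w => nrm2 ((Z w) ^t* *m (Y w *m xi l w))) <=
   I (fun w => nrm2 ((Z w) ^t* *m Y w)))%E.
Proof.
move=> mY mZ; have e a (A : 'M[C]_(b, a)) (B : 'M[C]_(b, c)) :
    nrm2 (B ^t* *m A) = nrm2 (A ^t* *m B).
  by rewrite -nrm2_adj (adjM (_ ^t*)) trmxCK.
under eq_integral do rewrite e.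
under [leRHS]eq_integral do rewrite e.
exact: step_mean.
Qed.

(** For a letter occurring in both words the integrand is dominated by a linear functional of the
    square of G G^*, whose mean has norm at most [c2]. The price per letter is [c2], without any
    dimension. *)
Lemma step_fourth l b (Y : T -> 'M[C]_(b, p)) :
  mxmeas (Y : rest (inl l) -> _) ->
  (I (fun w => nrm2 ((Y w *m xi l w) ^t* *m (Y w *m xi l w))) <=
   I (fun w => c2 * nrm2 ((Y w) ^t* *m Y w)))%E.
Proof.
move=> mY; have mY' := mxmeas_rest_sub mY.
pose F (x : cmx R n) w := nrm2 ((Y w) ^t* *m Y w *m amp ((x : 'M[C]_n) *m x ^t*)).
apply: (@le_trans _ _ (I (fun w => F (G l w) w))).
  have mYx : mxmeas (fun w => Y w *m xi l w) by apply: mxmeasM => //; exact: mxmeas_xi.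
  apply: le_I => [w|||w]; first exact: nrm2_ge0.
  - by apply: meas_nrm2; apply: mxmeasM => //; exact: mxmeas_adj.
  - apply: meas_nrm2; apply: mxmeasM.
      by apply: mxmeasM => //; exact: mxmeas_adj.
    by have mGl := mxmeas_G l; apply: mxmeas_amp; exact: mxmeasM mGl (mxmeas_adj mGl).
  - exact: nrm2_conj_amp_le.
apply: tonelli_G => [|||w].
- apply: meas_nrm2; apply: mxmeasM.
    have m2 := mxmeas_comp mY (@measurable_snd _ _ (cmx R n) _).
    by apply: mxmeasM => //; exact: mxmeas_adj.
  have m1 := mxmeas_comp (@mxmeas_id R n) (@measurable_fst _ _ _ (rest (inl l))).
  exact: (mxmeas_amp (mxmeasM m1 (mxmeas_adj m1))).
- by move=> x w; exact: nrm2_ge0.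
- apply: measurable_funM => //.
  by apply: meas_nrm2; apply: mxmeasM => //; exact: mxmeas_adj.
- under eq_integral do rewrite /F nrm2_amp4.
  rewrite (integral_retr hG4_int) -tr_amp lee_fin.
  move: ((Y w) ^t* *m Y w) => N; apply: le_trans (ip_amp_opnorm N c20 hG4).
  move: (amp _) => K; rewrite ipC /ip.
  have -> : \tr (N ^t* *m N *m K) = \tr (N *m K *m N ^t*).
    by rewrite -mulmxA mxtrace_mulC.
  exact: lexx.
Qed.

Lemma step_haar l b (L W : T -> 'M[C]_(p, b)) : (0 < p)%N ->
  mxmeas (L : rest (inr l) -> _) -> mxmeas (W : rest (inr l) -> _) ->
  (I (fun w => nrm2 ((L w) ^t* *m upart (H l w) *m W w)) <=
   I (fun w => p%:R^-1 * (nrm2 (L w) * nrm2 (W w))))%E.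
Proof.
move=> p0 mL mW.
apply: (@tonelli_H l (fun x w => nrm2 ((L w) ^t* *m upart x *m W w))) => [|||w].
- apply: meas_nrm2; apply: mxmeasM.
    apply: mxmeasM; first by apply: mxmeas_adj; exact: (mxmeas_comp mL measurable_snd).
    exact: (mxmeas_comp (@mxmeas_upart R p) measurable_fst).
  exact: (mxmeas_comp mW measurable_snd).
- by move=> x w; exact: nrm2_ge0.
- by apply: measurable_funM => //; apply: measurable_funM; exact: meas_nrm2.
- exact: (haar_nrm2_le p0 (hH l) (L w) (W w)).
Qed.

Lemma step_moment l a (b : R) (f : T -> R) : 0 <= b ->
  (\int[calG]_x (nrm2 (x : 'M[C]_n) ^+ a)%:E <= b%:E)%E ->
  measurable_fun [set: rest (inl l)] f -> (forall w, 0 <= f w) ->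
  (I (fun w => (nrm2 (G l w : 'M[C]_n) ^+ a * f w)%R) <= I (fun w => (b * f w)%R))%E.
Proof.
move=> b0 hb mf f0.
have mg : measurable_fun setT (fun x : cmx R n => nrm2 (x : 'M[C]_n) ^+ a).
  by apply: measurable_funX; apply: meas_nrm2; exact: mxmeas_id.
apply: (@tonelli_G l (fun x w => nrm2 (x : 'M[C]_n) ^+ a * f w)) => [|||w].
- apply: measurable_funM; first exact: (measurableT_comp mg).
  exact: (measurableT_comp mf measurable_snd).
- by move=> x w; rewrite mulr_ge0 ?exprn_ge0 ?nrm2_ge0.
- exact: measurable_funM.
- under eq_integral do rewrite mulrC EFinM.
  rewrite ge0_integralZl//.
  + by rewrite mulrC EFinM lee_wpmul2l ?lee_fin.
  + exact/measurable_EFinP.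
  + by move=> x _; rewrite lee_fin exprn_ge0 ?nrm2_ge0.
  + by rewrite lee_fin.
Qed.

Lemma moment0 : (\int[calG]_x (nrm2 (x : 'M[C]_n) ^+ 0)%:E <= 1)%E.
Proof.
under eq_integral do rewrite expr0.
by rewrite integral_cst// mul1e; exact: probability_le1.
Qed.

Lemma moment1 : (\int[calG]_x (nrm2 (x : 'M[C]_n) ^+ 1)%:E <= n%:R%:E)%E.
Proof.
have -> : (\int[calG]_x (nrm2 (x : 'M[C]_n) ^+ 1)%:E =
   \int[calG]_x (complex.Re (\tr (1%:M *m ((x : 'M[C]_n) *m x ^t*))))%:E)%E.
  by apply: eq_integral => x _; rewrite expr1 mul1mx.
rewrite (integral_retr hG2_int) hG2 mulmx1 mxtrace1 -(rmorph_nat (real_complex R)).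
exact: lexx.
Qed.

(** One factor n comes from [sqr_nrm2_le], the other from bounding an n by n trace by the operator
    norm. *)
Lemma moment2 : (\int[calG]_x (nrm2 (x : 'M[C]_n) ^+ 2)%:E <= (n%:R ^+ 2 * c2)%:E)%E.
Proof.
have e (x : cmx R n) : n%:R * nrm2 ((x : 'M[C]_n) *m x ^t*) =
    complex.Re (\tr (n%:R%:M *m ((x : 'M[C]_n) *m x ^t*) ^+ 2)).
  rewrite mul_scalar_mx mxtraceZ ReM -(rmorph_nat (real_complex R)) /= mul0r subr0.
  by rewrite /nrm2 /ip expr2 adjM trmxCK.
apply: (@le_trans _ _ (\int[calG]_x (n%:R * nrm2 ((x : 'M[C]_n) *m x ^t*))%:E)%E).
  have mx := @mxmeas_id R n.
  apply: ge0_le_integral => //.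
  - by move=> x _; rewrite lee_fin exprn_ge0 ?nrm2_ge0.
  - by apply/measurable_EFinP; apply: measurable_funX; exact: meas_nrm2.
  - apply/measurable_EFinP; apply: measurable_funM => //; apply: meas_nrm2.
    by apply: mxmeasM => //; exact: mxmeas_adj.
  - by move=> x _; rewrite lee_fin sqr_nrm2_le.
under eq_integral do rewrite e.
rewrite (integral_retr hG4_int) lee_fin mul_scalar_mx mxtraceZ ReM.
rewrite -(rmorph_nat (real_complex R)) /= mul0r subr0 expr2 -mulrA.
by rewrite ler_wpM2l ?ler0n// mulrC nrm2_tr.
Qed.

(** * Words along a list of indices, and their moments *)

Lemma rest_xi s l : inl l != s -> inr l != s -> mxmeas (xi l : rest s -> _).
Proof.
by move=> ls rs; apply: mxmeasM; [exact/mxmeas_amp/rest_G|exact: rest_H].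
Qed.

(** Taken along a list so that letters can be removed one by one; along the full enumeration of the
    indices it is X_S. *)
Definition word (r : seq 'I_m) (S : {set 'I_m}) w : 'M[C]_p :=
  \prod_(i <- r | i \in S) xi i w.

Lemma word_nil S w : word [::] S w = 1%:M.
Proof. by rewrite /word big_nil. Qed.

Lemma word_cat r1 r2 S w : word (r1 ++ r2) S w = word r1 S w *m word r2 S w.
Proof. by rewrite /word big_cat. Qed.

Lemma word_seq1 l S w : word [:: l] S w = if l \in S then xi l w else 1%:M.
Proof. by rewrite /word big_mkcond big_seq1. Qed.

Lemma word_cons l r S w :
  word (l :: r) S w = (if l \in S then xi l w else 1%:M) *m word r S w.
Proof. by rewrite -cat1s word_cat word_seq1. Qed.

Lemma mul_word_rcons a (M : 'M[C]_(a, p)) r l S w : M *m word (rcons r l) S w =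
  if l \in S then M *m word r S w *m xi l w else M *m word r S w.
Proof.
by rewrite -cats1 word_cat word_seq1 mulmxA; case: ifP => // _; rewrite mulmx1.
Qed.

Lemma rest_word s r S : (forall i, i \in r -> inl i != s /\ inr i != s) ->
  mxmeas (word r S : rest s -> _).
Proof. by move=> rs; apply: mxmeas_prod => i /rs[? ?] _; exact: rest_xi. Qed.

Lemma rest_wordl l r S : l \notin r -> mxmeas (word r S : rest (inl l) -> _).
Proof.
by move=> lr; apply: rest_word => i ir; split=> //; apply: contraNneq lr => -[<-].
Qed.

Lemma rest_wordr l r S : l \notin r -> mxmeas (word r S : rest (inr l) -> _).
Proof.
by move=> lr; apply: rest_word => i ir; split=> //; apply: contraNneq lr => -[<-].
Qed.

Lemma mxmeas_word r S : mxmeas (word r S).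
Proof. by apply: mxmeas_prod => i _ _; exact: mxmeas_xi. Qed.

Local Notation J := (pid_mx n : 'M[C]_(n, p)).

Hypothesis k0 : (0 < k)%N.

Lemma JJ : J *m J ^t* = 1%:M.
Proof.
have np : (n <= p)%N by rewrite leq_pmulr.
by rewrite tr_pid_mx map_pid_mx mul_pid_mx minnn (minn_idPr np) pid_mx_1.
Qed.

Lemma nrm2_J : nrm2 J = n%:R.
Proof. by rewrite /nrm2 /ip JJ mxtrace1 -(rmorph_nat (real_complex R)). Qed.

Lemma nrm2_JMJ (M : 'M[C]_n) : nrm2 (J ^t* *m M *m J) = nrm2 M.
Proof.
by rewrite /nrm2 ip_mulr -[X in ip _ X]mulmxA JJ mulmx1 ip_mull trmxCK mulmxA JJ mul1mx.
Qed.

Lemma I_cst (x : R) : (I (fun _ : T => x) = x%:E)%E.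
Proof.
rewrite integral_cst// -[RHS]mule1; congr (_ * _)%E; exact: probability_setT.
Qed.

Lemma I_Zl (x : R) (f : T -> R) : 0 <= x -> (forall w, 0 <= f w) ->
  measurable_fun setT f -> (I (fun w => x * f w)%R = x%:E * I f)%E.
Proof.
move=> x0 f0 mf; under eq_integral do rewrite EFinM.
rewrite ge0_integralZl//; first exact/measurable_EFinP.
by move=> w _; rewrite lee_fin.
Qed.

(** Letters are removed from the right, since the rightmost one is innermost in X_S X_S^*. Each
    costs [c2], and the empty word leaves |J J^*|_2^2 = n. *)
Lemma word_fourth r S : uniq r ->
  (I (fun w => nrm2 ((J *m word r S w) ^t* *m (J *m word r S w))) <=
   (c2 ^+ count (mem S) r * n%:R)%:E)%E.
Proof.
elim/last_ind: r => [_|r l ih].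
  rewrite expr0 mul1r -I_cst.
  apply: le_I => [w|||w]; [exact: nrm2_ge0| |exact: measurable_cst|].
    by under eq_fun do rewrite word_nil; exact: measurable_cst.
  rewrite word_nil mulmx1 nrm2_mulC JJ nrm2_1; exact: lexx.
rewrite rcons_uniq => /andP[lr /ih {}ih].
rewrite -cats1 count_cat /= addn0 cats1.
under eq_integral do rewrite mul_word_rcons.
case: (boolP (l \in S)) => lS; last by rewrite addn0.
have mY : mxmeas ((fun w => J *m word r S w) : rest (inl l) -> _).
  by apply: mxmeasM; [exact: mxmeas_cst|exact: rest_wordl].
apply: le_trans (step_fourth mY) _; have mY' := mxmeas_rest_sub mY.
rewrite (@I_Zl c2 (fun w => nrm2 ((J *m word r S w) ^t* *m (J *m word r S w))))//.
- by rewrite addn1 exprS -mulrA EFinM lee_wpmul2l ?lee_fin.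
- by move=> w; exact: nrm2_ge0.
- by apply: meas_nrm2; exact: (mxmeasM (mxmeas_adj mY') mY').
Qed.

(** By disjointness an index contributes a letter to at most one of the two words, so every removal
    is a [step_mean] on one side or the other. No power of [c2] arises. *)
Lemma word_mean r (A B : {set 'I_m}) (QA QB : 'M[C]_n) : uniq r ->
  (forall i, i \in A -> i \notin B) ->
  (I (fun w => nrm2 ((QA *m J *m word r A w) ^t* *m (QB *m J *m word r B w))) <=
   (nrm2 (QA ^t* *m QB))%:E)%E.
Proof.
move=> + dAB; elim/last_ind: r => [_|r l ih].
  rewrite -I_cst; apply: le_I => [w|||w]; [exact: nrm2_ge0| |exact: measurable_cst|].
    by under eq_fun do rewrite !word_nil; exact: measurable_cst.
  rewrite !word_nil !mulmx1 -nrm2_JMJ adjM !mulmxA; exact: lexx.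
rewrite rcons_uniq => /andP[lr /ih {}ih].
have mY (Q : 'M[C]_n) S : mxmeas ((fun w => Q *m J *m word r S w) : rest (inl l) -> _).
  by apply: mxmeasM; [exact: mxmeas_cst|exact: rest_wordl].
under eq_integral do rewrite !mul_word_rcons.
apply: le_trans ih.
case: (boolP (l \in A)) => lA; case: (boolP (l \in B)) => lB.
- by exfalso; move/negP: (dAB l lA); apply.
- exact: (step_mean (mY QA A) (mY QB B)).
- exact: (step_mean_sym (mY QB B) (mY QA A)).
- exact: lexx.
Qed.

(** A scalar majorant for the words. Unlike the matrices, its factors commute, so its moments split
    over the indices by independence. *)
Definition gprod (r : seq 'I_m) (S : {set 'I_m}) w : R :=
  \prod_(i <- r | i \in S) nrm2 (G i w : 'M[C]_n).

Lemma gprod_ge0 r S w : 0 <= gprod r S w.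
Proof. by apply: prodr_ge0 => i _; exact: nrm2_ge0. Qed.

Lemma gprod_cons l r S w :
  gprod (l :: r) S w = nrm2 (G l w : 'M[C]_n) ^+ (l \in S) * gprod r S w.
Proof. by rewrite /gprod big_cons; case: (l \in S); rewrite ?expr1// expr0 mul1r. Qed.

Lemma gprod_cat r1 r2 S w : gprod (r1 ++ r2) S w = gprod r1 S w * gprod r2 S w.
Proof. by rewrite /gprod big_cat. Qed.

Lemma rest_gprod l r S : l \notin r -> measurable_fun [set: rest (inl l)] (gprod r S).
Proof.
elim: r => [_|i r ih].
  have -> : gprod [::] S = fun=> 1 by apply/funext => w; rewrite /gprod big_nil.
  exact: measurable_cst.
rewrite inE negb_or => /andP[li /ih {}ih].
have -> : gprod (i :: r) S =
    fun w => nrm2 (G i w : 'M[C]_n) ^+ (i \in S) * gprod r S w.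
  by apply/funext => w; exact: gprod_cons.
apply: measurable_funM => //; apply: measurable_funX; apply: meas_nrm2.
by apply: rest_G; apply: contraNneq li => -[<-].
Qed.

Lemma meas_gprod r S : measurable_fun [set: T] (gprod r S).
Proof.
elim: r => [|i r ih].
  have -> : gprod [::] S = fun=> 1 by apply/funext => w; rewrite /gprod big_nil.
  exact: measurable_cst.
have -> : gprod (i :: r) S =
    fun w => nrm2 (G i w : 'M[C]_n) ^+ (i \in S) * gprod r S w.
  by apply/funext => w; exact: gprod_cons.
by apply: measurable_funM => //; apply: measurable_funX; apply: meas_nrm2; exact: mxmeas_G.
Qed.

Lemma nrm2_xi a (M : 'M[C]_(a, p)) l w :
  nrm2 (M *m xi l w) <= nrm2 (G l w : 'M[C]_n) * nrm2 M.
Proof.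
rewrite /xi mulmxA nrm2_mul_upart; apply: le_trans (nrm2_amp_le _ _).
by rewrite ler_piMl ?nrm2_ge0 ?uind_le1.
Qed.

Lemma nrm2_xi_adj a (M : 'M[C]_(a, p)) l w :
  nrm2 (M *m (xi l w) ^t*) <= nrm2 (G l w : 'M[C]_n) * nrm2 M.
Proof.
rewrite /xi adjM mulmxA adj_tens; apply: le_trans (nrm2_amp_le _ _) _.
rewrite nrm2_adj nrm2_mul_upart_adj ler_wpM2l ?nrm2_ge0//.
by rewrite ler_piMl ?nrm2_ge0 ?uind_le1.
Qed.

Lemma nrm2_word a (M : 'M[C]_(a, p)) r S w :
  nrm2 (M *m word r S w) <= gprod r S w * nrm2 M.
Proof.
elim: r a M => [|l r ih] a M.
  rewrite word_nil mulmx1 /gprod big_nil mul1r; exact: lexx.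
rewrite word_cons mulmxA; apply: le_trans (ih _ _) _.
rewrite gprod_cons (mulrC (_ ^+ _)) -mulrA ler_wpM2l ?gprod_ge0//.
by case: (l \in S); rewrite ?expr1 ?expr0 ?mulmx1 ?mul1r// nrm2_xi.
Qed.

Lemma nrm2_word_adj a (M : 'M[C]_(a, p)) r S w :
  nrm2 (M *m (word r S w) ^t*) <= gprod r S w * nrm2 M.
Proof.
elim: r => [|l r ih].
  rewrite word_nil adj1 mulmx1 /gprod big_nil mul1r; exact: lexx.
rewrite word_cons adjM mulmxA gprod_cons -mulrA.
case: (l \in S); last by rewrite adj1 mulmx1 expr0 mul1r.
apply: le_trans (nrm2_xi_adj _ _ _) _.
by rewrite expr1 ler_wpM2l ?nrm2_ge0.
Qed.

Lemma last_diff (r : seq 'I_m) (S S' : {set 'I_m}) :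
  has (fun i => (i \in S) != (i \in S')) r -> exists r1 l r2,
  [/\ r = r1 ++ l :: r2, (l \in S) != (l \in S') &
      forall i, i \in r2 -> (i \in S) = (i \in S')].
Proof.
elim/last_ind: r => [//|r l ih]; rewrite has_rcons.
have [e|ne] := eqVneq (l \in S) (l \in S'); last first.
  by move=> _; exists r, l, [::]; rewrite cats1.
move=> /= /ih [r1 [l' [r2 [-> nl' h]]]]; exists r1, l', (rcons r2 l).
split=> // [|i]; first by rewrite rcons_cat.
by rewrite mem_rcons inE => /predU1P[->|/h].
Qed.

Lemma eq_word r (S S' : {set 'I_m}) w : (forall i, i \in r -> (i \in S) = (i \in S')) ->
  word r S w = word r S' w.
Proof.
move=> h; rewrite /word big_seq_cond [RHS]big_seq_cond; apply: eq_bigl => i.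
by case: (boolP (i \in r)) => //= /h ->.
Qed.

Lemma eq_gprod r (S S' : {set 'I_m}) w : (forall i, i \in r -> (i \in S) = (i \in S')) ->
  gprod r S w = gprod r S' w.
Proof.
move=> h; rewrite /gprod big_seq_cond [RHS]big_seq_cond; apply: eq_bigl => i.
by case: (boolP (i \in r)) => //= /h ->.
Qed.

Hypothesis n0 : (0 < n)%N.

(* The Haar average is taken over the last variable on which the two words differ;
   everything to its right occurs as [Z Z^*]. *)
Lemma word_offdiag_pair r (S S' : {set 'I_m}) r1 l r2 : uniq r -> r = r1 ++ l :: r2 ->
  l \in S -> l \notin S' -> (forall i, i \in r2 -> (i \in S) = (i \in S')) ->
  (I (fun w => nrm2 (J *m word r S w *m (J *m word r S' w) ^t*)) <=
   I (fun w => p%:R^-1 * (n%:R ^+ 2 * (gprod r S w * gprod r S' w))))%E.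
Proof.
move=> ur er lS lS' h2.
have /and3P[_ lr1 /andP[lr2 _]] : [&& uniq r1, l \notin r1 & uniq (l :: r2)].
  by move: ur; rewrite er cat_uniq => /and3P[-> /hasPn/(_ l (mem_head _ _)) -> ->].
have p0 : (0 < p)%N by rewrite muln_gt0 n0.
(* The product is cut at [upart (H l)], which occurs once because [l] lies in [S] only: [L] gathers
   what stands before it and [W] what stands after it, and neither involves [H l]. *)
pose L w : 'M[C]_(p, n) := (J *m word r1 S w *m amp (G l w)) ^t*.
pose W w : 'M[C]_(p, n) := word r2 S w *m (word r2 S w) ^t* *m (word r1 S' w) ^t* *m J ^t*.
have eLW w : J *m word r S w *m (J *m word r S' w) ^t* = (L w) ^t* *m upart (H l w) *m W w.
  rewrite er !word_cat !word_cons lS (negPf lS') mul1mx.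
  rewrite -(@eq_word r2 S S' w h2) /L /W trmxCK /xi.
  move: (word r1 S w) (word r1 S' w) (word r2 S w) (amp _) (upart _) (J) => A B D K u j.
  by rewrite !adjM !mulmxA.
under eq_integral do rewrite eLW.
have mL : mxmeas (L : rest (inr l) -> _).
  apply: mxmeas_adj; apply: mxmeasM; last exact/mxmeas_amp/rest_G.
  by apply: mxmeasM; [exact: mxmeas_cst|exact: rest_wordr].
have mW : mxmeas (W : rest (inr l) -> _).
  apply: mxmeasM; last exact: mxmeas_cst.
  apply: mxmeasM; last exact/mxmeas_adj/rest_wordr.
  by apply: mxmeasM; [|apply: mxmeas_adj]; exact: rest_wordr.
apply: le_trans (step_haar p0 mL mW) _.
have mL' := mxmeas_rest_sub mL; have mW' := mxmeas_rest_sub mW.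
apply: le_I => [w|||w].
- by rewrite !mulr_ge0 ?invr_ge0 ?ler0n ?nrm2_ge0.
- by apply: measurable_funM => //; apply: measurable_funM; exact: meas_nrm2.
- do 2!apply: measurable_funM => //; apply: measurable_funM; exact: meas_gprod.
rewrite ler_wpM2l ?invr_ge0 ?ler0n// er !gprod_cat !gprod_cons lS (negPf lS').
rewrite expr1 expr0 mul1r -(@eq_gprod r2 S S' w h2).
have hL : nrm2 (L w) <= nrm2 (G l w : 'M[C]_n) * (gprod r1 S w * n%:R).
  rewrite /L nrm2_adj; apply: le_trans (nrm2_amp_le _ _) _.
  rewrite ler_wpM2l ?nrm2_ge0//; apply: le_trans (nrm2_word _ _ _ _) _.
  by rewrite nrm2_J.
have hW : nrm2 (W w) <= gprod r2 S w * (gprod r2 S w * (gprod r1 S' w * n%:R)).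
  have -> : W w = (J *m word r1 S' w *m word r2 S w *m (word r2 S w) ^t*) ^t*.
    rewrite /W; move: (word r2 S w) (word r1 S' w) (J) => A B j.
    by rewrite !adjM trmxCK !mulmxA.
  rewrite nrm2_adj; apply: le_trans (nrm2_word_adj _ _ _ _) _.
  rewrite ler_wpM2l ?gprod_ge0//; apply: le_trans (nrm2_word _ _ _ _) _.
  rewrite ler_wpM2l ?gprod_ge0//; apply: le_trans (nrm2_word _ _ _ _) _.
  by rewrite nrm2_J.
apply: le_trans (ler_pM (nrm2_ge0 _) (nrm2_ge0 _) hL hW) _.
move: (nrm2 _) (gprod r1 S w) (gprod r1 S' w) (gprod r2 S w) (n%:R : R) => x y z t s.
by rewrite le_eqVlt; apply/orP; left; apply/eqP; ring.
Qed.

Lemma word_offdiag r (S S' : {set 'I_m}) : uniq r -> has (fun i => (i \in S) != (i \in S')) r ->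
  (I (fun w => nrm2 (J *m word r S w *m (J *m word r S' w) ^t*)) <=
   I (fun w => p%:R^-1 * (n%:R ^+ 2 * (gprod r S w * gprod r S' w))))%E.
Proof.
move=> ur /last_diff[r1 [l [r2 [er nl h2]]]].
have [lS|lS] := boolP (l \in S).
  have lS' : l \notin S' by move: nl; rewrite lS; case: (l \in S').
  exact: (word_offdiag_pair ur er lS lS' h2).
have lS' : l \in S' by move: nl; rewrite (negPf lS); case: (l \in S').
have sym (A B : 'M[C]_(n, p)) : nrm2 (A *m B ^t*) = nrm2 (B *m A ^t*).
  by rewrite -nrm2_adj adjM trmxCK.
have eL : I (fun w => nrm2 (J *m word r S w *m (J *m word r S' w) ^t*)) =
          I (fun w => nrm2 (J *m word r S' w *m (J *m word r S w) ^t*)).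
  by apply: eq_integral => w _; exact: (congr1 EFin (sym _ _)).
have eR : I (fun w => p%:R^-1 * (n%:R ^+ 2 * (gprod r S w * gprod r S' w))) =
          I (fun w => p%:R^-1 * (n%:R ^+ 2 * (gprod r S' w * gprod r S w))).
  by apply: eq_integral => w _; congr (_ * (_ * _))%:E; exact: mulrC.
rewrite eL eR; exact: (word_offdiag_pair ur er lS' lS (fun i ir => esym (h2 i ir))).
Qed.

(** Bounds E |G|_2^{2a} for a = 0, 1, 2, the only exponents that an index receives from two sets;
    these stay within the fourth moment. *)
Definition mbound (a : nat) : R := if a is 0 then 1 else if a is 1 then n%:R else n%:R ^+ 2 * c2.

Lemma gprod_moment r (S S' : {set 'I_m}) : uniq r -> (I (fun w => (gprod r S w * gprod r S' w)%R) <=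
  (\prod_(i <- r) mbound ((i \in S) + (i \in S')))%:E)%E.
Proof.
elim: r => [_|l r ih /andP[lr /ih {}ih]].
  rewrite big_nil -I_cst; apply: le_I => [w|||w].
  - by rewrite mulr_ge0 ?gprod_ge0.
  - by apply: measurable_funM; exact: meas_gprod.
  - exact: measurable_cst.
  - by rewrite /gprod !big_nil mulr1.
have mb0 a : 0 <= mbound a.
  by rewrite /mbound; case: a => [|[|a]]; rewrite ?ler01 ?ler0n ?mulr_ge0 ?exprn_ge0 ?ler0n.
have mom : (\int[calG]_x (nrm2 (x : 'M[C]_n) ^+ ((l \in S) + (l \in S')))%:E <=
    (mbound ((l \in S) + (l \in S')))%:E)%E.
  case: (l \in S); case: (l \in S') => /=.
  - exact: moment2.
  - exact: moment1.
  - exact: moment1.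
  - exact: moment0.
have -> : (I (fun w => (gprod (l :: r) S w * gprod (l :: r) S' w)%R) =
   I (fun w => (nrm2 (G l w : 'M[C]_n) ^+ ((l \in S) + (l \in S')) *
     (gprod r S w * gprod r S' w))%R))%E.
  apply: eq_integral => w _; congr EFin; rewrite !gprod_cons exprD.
  move: (nrm2 _ ^+ _) (nrm2 _ ^+ _) (gprod _ _ _) (gprod _ _ _) => x y z t.
  by rewrite mulrACA.
have g0 w : 0 <= gprod r S w * gprod r S' w by rewrite mulr_ge0 ?gprod_ge0.
apply: le_trans (step_moment (mb0 _) mom _ g0) _.
  by apply: measurable_funM; exact: rest_gprod.
rewrite (I_Zl (mb0 _) g0); last by apply: measurable_funM; exact: meas_gprod.
by rewrite big_cons EFinM lee_wpmul2l ?lee_fin.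
Qed.

Local Notation E := (index_enum 'I_m).

Lemma uniqE : uniq E.
Proof. exact: index_enum_uniq. Qed.

Lemma I_sum_le (K : finType) (f : K -> T -> R) (b : K -> R) :
  (forall i w, 0 <= f i w) -> (forall i, measurable_fun setT (f i)) ->
  (forall i, (I (f i) <= (b i)%:E)%E) ->
  (I (fun w => \sum_i f i w) <= (\sum_i b i)%:E)%E.
Proof.
move=> f0 mf fb; under eq_integral do rewrite -sumEFin.
rewrite ge0_integral_sum//.
- by rewrite -sumEFin; apply: lee_sum => i _.
- by move=> i; exact/measurable_EFinP.
- by move=> i w _; rewrite lee_fin.
Qed.

(** * The diagonal and off-diagonal parts of the fourth moment *)

Section polynomial.
Variables (Q : ncpoly R m n) (d : nat).
Hypotheses (c21 : 1 <= c2) (Qd : forall S : {set 'I_m}, (d < #|S|)%N -> Q S = 0).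

Let V (S : {set 'I_m}) w : 'M[C]_(n, p) := Q S *m J *m word E S w.

Let mV S : mxmeas (V S).
Proof. by apply: mxmeasM; [exact: mxmeas_cst|exact: mxmeas_word]. Qed.

Let y (S : {set 'I_m}) w := nrm2 ((J *m word E S w) ^t* *m (J *m word E S w)).

Let my S : measurable_fun setT (y S).
Proof.
have mJ : mxmeas (fun w => J *m word E S w).
  by apply: mxmeasM; [exact: mxmeas_cst|exact: mxmeas_word].
by apply: meas_nrm2; exact: (mxmeasM (mxmeas_adj mJ) mJ).
Qed.

Let count_card (S : {set 'I_m}) : count (mem S) E = #|S|.
Proof. by rewrite cardE /enum_mem size_filter. Qed.

Let Iy (S : {set 'I_m}) : (#|S| <= d)%N -> (I (y S) <= (c2 ^+ d * n%:R)%:E)%E.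
Proof.
move=> Sd; apply: le_trans (word_fourth S uniqE) _.
by rewrite lee_fin ler_wpM2r ?ler0n// count_card ler_weXn2l.
Qed.

Let nrm2_VV S w : nrm2 (V S w *m (V S w) ^t*) <= nrm2 (Q S) ^+ 2 * y S w.
Proof.
rewrite /V /y nrm2_mulC -(mulmxA (Q S)); move: (J *m word E S w) => Z.
rewrite adjM mulmxA -(mulmxA (Q S)); apply: le_trans (nrm2M_le _ _) _.
rewrite nrm2_adj mulrC expr2 -mulrA ler_wpM2l ?nrm2_ge0//.
exact: nrm2M_le.
Qed.

(** Bounds E |V_A^* V_B|_2^2. The disjoint case is free of any loss, which is why the Boolean fourth
    moment enters the result with constant 1. *)
Definition diag_bound (A B : {set 'I_m}) : R :=
  if A :&: B == finset.set0 then nrm2 ((Q A) ^t* *m Q B)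
  else nrm2 (Q A) * nrm2 (Q B) * (c2 ^+ d * n%:R).

Let V0 (S : {set 'I_m}) w : (d < #|S|)%N -> V S w = 0.
Proof. by move=> /Qd QS; rewrite /V QS !mul0mx. Qed.

Let nrm2_0 a b : nrm2 (0 : 'M[C]_(a, b)) = 0.
Proof. by rewrite /nrm2 /ip mul0mx mxtrace0. Qed.

Let c2n0 : 0 <= c2 ^+ d * n%:R.
Proof. by rewrite mulr_ge0 ?exprn_ge0 ?ler0n. Qed.

Let diag_bound_ge0 A B : 0 <= diag_bound A B.
Proof.
rewrite /diag_bound; case: ifP => _; first exact: nrm2_ge0.
by apply: mulr_ge0 c2n0; apply: mulr_ge0; exact: nrm2_ge0.
Qed.

Let IVV (A B : {set 'I_m}) : (I (fun w => nrm2 ((V A w) ^t* *m V B w)) <= (diag_bound A B)%:E)%E.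
Proof.
have mAB : measurable_fun setT (fun w => nrm2 ((V A w) ^t* *m V B w)).
  by apply: meas_nrm2; exact: (mxmeasM (mxmeas_adj (mV A)) (mV B)).
have zero : (forall w, nrm2 ((V A w) ^t* *m V B w) = 0) ->
    (I (fun w => nrm2 ((V A w) ^t* *m V B w)) <= (diag_bound A B)%:E)%E.
  move=> h; have -> : I (fun w => nrm2 ((V A w) ^t* *m V B w)) = I (fun=> 0).
    by apply: eq_integral => w _; exact: (congr1 EFin (h w)).
  by rewrite I_cst lee_fin; exact: diag_bound_ge0.
have [Ad|dA] := leqP #|A| d; last first.
  by apply: zero => w; rewrite (V0 _ dA) trmx0 map_mx0 mul0mx nrm2_0.
have [Bd|dB] := leqP #|B| d; last first.
  by apply: zero => w; rewrite (V0 _ dB) mulmx0 nrm2_0.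
rewrite /diag_bound; case: ifPn => [/eqP AB0|_].
  apply: word_mean; first exact: uniqE.
  move=> i iA; apply/negP => iB.
  have : i \in A :&: B by rewrite inE iA iB.
  by rewrite AB0 inE.
pose q := nrm2 (Q A) * nrm2 (Q B).
have q0 : 0 <= q by rewrite mulr_ge0 ?nrm2_ge0.
have y0 S w : 0 <= y S w by exact: nrm2_ge0.
(* For sets that meet, [ip_psd] and [ip_le] separate the two words pointwise, so only the fourth
   moment of a single word is needed. *)
apply: (@le_trans _ _ (I (fun w => q / 2 * (y A w + y B w)))).
  apply: le_I => [w|||w]; [exact: nrm2_ge0|exact: mAB| |].
    exact: (measurable_funM (measurable_cst _) (measurable_funD (my A) (my B))).
  rewrite -ip_psd.
  have := @ip_le R _ _ (V A w *m (V A w) ^t*) (V B w *m (V B w) ^t*) q (y A w) (y B w)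
    q0 (y0 _ _) (y0 _ _).
  have h : nrm2 (V A w *m (V A w) ^t*) * nrm2 (V B w *m (V B w) ^t*) <=
      q ^+ 2 * (y A w * y B w).
    apply: le_trans (ler_pM (nrm2_ge0 _) (nrm2_ge0 _) (nrm2_VV A w) (nrm2_VV B w)) _.
    rewrite /q; move: (nrm2 (Q A)) (nrm2 (Q B)) (y A w) (y B w) => a b u v.
    by rewrite le_eqVlt; apply/orP; left; apply/eqP; ring.
  move/(_ h); move: (ip _ _) (y A w) (y B w) => a u v; rewrite -mulrA (mulrC 2^-1) mulrA.
  by rewrite ler_pdivlMr// mulrC.
have q20 : 0 <= q / 2 by rewrite divr_ge0.
have yy0 w : 0 <= y A w + y B w by exact: addr_ge0.
rewrite (I_Zl q20 yy0 (measurable_funD (my A) (my B))).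
under eq_integral do rewrite EFinD.
rewrite ge0_integralD//; first last.
- exact/measurable_EFinP/my.
- by move=> w _; rewrite lee_fin; exact: y0.
- exact/measurable_EFinP/my.
- by move=> w _; rewrite lee_fin; exact: y0.
apply: le_trans (_ : ((q / 2)%:E * ((c2 ^+ d * n%:R)%:E + (c2 ^+ d * n%:R)%:E) <= _)%E).
  by rewrite lee_wpmul2l ?lee_fin ?divr_ge0// leeD// Iy.
rewrite -EFinD -EFinM lee_fin -/q; move: (q) (c2 ^+ d * n%:R) => u z.
by rewrite le_eqVlt; apply/orP; left; apply/eqP; field.
Qed.

(** The factor 1/p is the Haar gain and n^2 comes from two copies of |J|_2^2 = n. In the moments of
    the G_i each of the m indices costs at most n^2, and [c2] only if it lies in both sets. Keeping
    this exponent, rather than [d], makes [c2] disappear for disjoint sets. *)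
Definition off_bound (S S' : {set 'I_m}) : R := if S == S' then 0 else
  nrm2 (Q S) * nrm2 (Q S') *
  (p%:R^-1 * (n%:R ^+ 2 * (n%:R ^+ (2 * m) * c2 ^+ #|S :&: S'|))).

Let mbound_prod (S S' : {set 'I_m}) :
  \prod_(i <- E) mbound ((i \in S) + (i \in S')) <= n%:R ^+ (2 * m) * c2 ^+ #|S :&: S'|.
Proof.
have n1 : (1 : R) <= n%:R by rewrite ler1n.
have -> : n%:R ^+ (2 * m) * c2 ^+ #|S :&: S'| =
    \prod_(i : 'I_m) (n%:R ^+ 2 * c2 ^+ (i \in S :&: S')) :> R.
  rewrite big_split /= prodr_const card_ord -exprM; congr (_ * _).
  rewrite (bigID (mem (S :&: S'))) /= [X in _ * X]big1 ?mulr1; last first.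
    by move=> i /negPf ->.
  under eq_bigr => i -> do rewrite expr1.
  by rewrite prodr_const.
apply: ler_prod => i _; rewrite inE /mbound.
have c0 : 0 <= c2 by [].
case: (i \in S); case: (i \in S') => /=; rewrite ?expr0 ?expr1 ?mulr1 ?lexx ?ler01 ?ler0n /=.
- by rewrite !mulr_ge0 ?exprn_ge0 ?ler0n.
- by rewrite ler_eXnr.
- by rewrite ler_eXnr.
- by rewrite exprn_ege1.
Qed.

Let IoffVV (S S' : {set 'I_m}) : S != S' ->
  (I (fun w => nrm2 (V S w *m (V S' w) ^t*)) <= (off_bound S S')%:E)%E.
Proof.
move=> SS'; rewrite /off_bound (negPf SS').
have hasE : has (fun i => (i \in S) != (i \in S')) E.
  apply/hasP; have [/existsP[i h]|] := boolP [exists i, (i \in S) != (i \in S')].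
    by exists i => //; exact: mem_index_enum.
  rewrite negb_exists => /forallP h; case/eqP: SS'; apply/setP => i.
  by apply/eqP; move: (h i); rewrite negbK.
pose q := nrm2 (Q S) * nrm2 (Q S').
have q0 : 0 <= q by rewrite mulr_ge0 ?nrm2_ge0.
pose u w := nrm2 (J *m word E S w *m (J *m word E S' w) ^t*).
have mw S0 : mxmeas (fun w => J *m word E S0 w).
  by apply: mxmeasM; [exact: mxmeas_cst|exact: mxmeas_word].
have mu : measurable_fun setT u.
  by apply: meas_nrm2; exact: (mxmeasM (mw S) (mxmeas_adj (mw S'))).
have u0 w : 0 <= u w by exact: nrm2_ge0.
apply: (@le_trans _ _ (I (fun w => q * u w))).
  apply: le_I => [w|||w]; first exact: nrm2_ge0.
  - by apply: meas_nrm2; exact: (mxmeasM (mV S) (mxmeas_adj (mV S'))).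
  - exact: measurable_funM.
  - rewrite /V /u /q -!(mulmxA (Q _)); move: (J *m word E S w) (J *m word E S' w) => A B.
    rewrite adjM !mulmxA -(mulmxA (Q S)); apply: le_trans (nrm2M_le _ _) _.
    rewrite nrm2_adj mulrC (mulrC (nrm2 (Q S))) -mulrA ler_wpM2l ?nrm2_ge0//.
    exact: nrm2M_le.
rewrite (I_Zl q0 u0 mu) -/q [leRHS]EFinM; apply: lee_wpmul2l; first by rewrite lee_fin.
apply: le_trans (word_offdiag uniqE hasE) _.
have g0 w : 0 <= gprod E S w * gprod E S' w by rewrite mulr_ge0 ?gprod_ge0.
have mg : measurable_fun setT (fun w => gprod E S w * gprod E S' w).
  by apply: measurable_funM; exact: meas_gprod.
have h1 w : 0 <= n%:R ^+ 2 * (gprod E S w * gprod E S' w).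
  by rewrite mulr_ge0 ?exprn_ge0 ?ler0n.
rewrite I_Zl ?invr_ge0 ?ler0n//; last exact: measurable_funM.
rewrite [leRHS]EFinM; apply: lee_wpmul2l; first by rewrite lee_fin invr_ge0 ler0n.
rewrite I_Zl ?exprn_ge0 ?ler0n// [leRHS]EFinM.
apply: lee_wpmul2l; first by rewrite lee_fin exprn_ge0 ?ler0n.
apply: le_trans (gprod_moment S S' uniqE) _.
by rewrite lee_fin mbound_prod.
Qed.

Let Nsets : R := #|{: {set 'I_m} * {set 'I_m}}|%:R.

(** The off-diagonal part is estimated crudely, with a factor for the number of pairs of sets: this
    depends on m alone and is harmless against the gain 1/p. *)
Lemma second_moment (e : R) : 0 < e ->
  (I (fun w => nrm2 ((\sum_S V S w) *m (\sum_S V S w) ^t*)) <=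
   ((1 + e) * (\sum_A \sum_B diag_bound A B) +
    (1 + e^-1) * (Nsets * \sum_(s : {set 'I_m} * {set 'I_m}) off_bound s.1 s.2))%:E)%E.
Proof.
move=> e0.
pose D w := \sum_S V S w *m (V S w) ^t*.
(* Zero on the diagonal, so that the off-diagonal part is a sum over all pairs and [nrm2_sum_le]
   applies. *)
pose o (s : {set 'I_m} * {set 'I_m}) w := if s.1 == s.2 then 0 else V s.1 w *m (V s.2 w) ^t*.
pose O w := \sum_s o s w.
have mo s : mxmeas (o s).
  rewrite /o; case: (s.1 == s.2); first exact: mxmeas_cst.
  exact: (mxmeasM (mV s.1) (mxmeas_adj (mV s.2))).
have mO : mxmeas O by exact: mxmeas_sum.
have mD : mxmeas D.
  by apply: mxmeas_sum => S; exact: (mxmeasM (mV S) (mxmeas_adj (mV S))).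
have mS : mxmeas (fun w => \sum_S V S w) by exact: mxmeas_sum.
have VDO w : (\sum_S V S w) *m (\sum_S V S w) ^t* = D w + O w.
  rewrite adj_sum mulmx_suml /D /O -(pair_big predT predT (fun S S' =>
    if S == S' then 0 else V S w *m (V S' w) ^t*)) /= -big_split /=.
  apply: eq_bigr => S _; rewrite mulmx_sumr (bigD1 S)//=; congr (_ + _).
  rewrite [RHS](bigD1 S)//= eqxx add0r; apply: eq_bigr => S' SS'.
  by rewrite eq_sym (negPf SS').
have e1 : 0 <= 1 + e by rewrite addr_ge0// ltW.
have e2 : 0 <= 1 + e^-1 by rewrite addr_ge0// invr_ge0 ltW.
apply: (@le_trans _ _ (I (fun w => ((1 + e) * nrm2 (D w) + (1 + e^-1) * nrm2 (O w))%R))).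
  apply: le_I => [w|||w]; first exact: nrm2_ge0.
  - by apply: meas_nrm2; exact: (mxmeasM mS (mxmeas_adj mS)).
  - by apply: measurable_funD; apply: measurable_funM => //; exact: meas_nrm2.
  - by rewrite VDO; exact: nrm2D_le.
under eq_integral do rewrite EFinD.
rewrite ge0_integralD//; first last.
- by apply/measurable_EFinP; apply: measurable_funM => //; exact: meas_nrm2.
- by move=> w _; rewrite lee_fin mulr_ge0 ?nrm2_ge0.
- by apply/measurable_EFinP; apply: measurable_funM => //; exact: meas_nrm2.
- by move=> w _; rewrite lee_fin mulr_ge0 ?nrm2_ge0.
have n2 a b (M : T -> 'M[C]_(a, b)) w : 0 <= nrm2 (M w) by exact: nrm2_ge0.
rewrite (I_Zl e1 (n2 _ _ D) (meas_nrm2 mD)) (I_Zl e2 (n2 _ _ O) (meas_nrm2 mO)).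
rewrite [leRHS]EFinD; apply: leeD; rewrite [leRHS]EFinM; apply: lee_wpmul2l;
  rewrite ?lee_fin//.
  have -> : I (fun w => nrm2 (D w)) =
      I (fun w => \sum_A \sum_B nrm2 ((V A w) ^t* *m V B w)).
    apply: eq_integral => w _; congr EFin; rewrite /nrm2 /D ip_suml.
    apply: eq_bigr => A _.
    by rewrite ip_sumr; apply: eq_bigr => B _; rewrite ip_psd.
  have mAB A B : measurable_fun setT (fun w => nrm2 ((V A w) ^t* *m V B w)).
    by apply: meas_nrm2; exact: (mxmeasM (mxmeas_adj (mV A)) (mV B)).
  apply: I_sum_le => [A w|A|A].
  - by apply: sumr_ge0 => B _; exact: nrm2_ge0.
  - by apply: measurable_sum => B; exact: mAB.
  - by apply: I_sum_le => [B w|B|B]; [exact: nrm2_ge0|exact: mAB|exact: IVV].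
apply: (@le_trans _ _ (I (fun w => Nsets * \sum_s nrm2 (o s w)))).
  apply: le_I => [w|||w]; [exact: nrm2_ge0|exact: meas_nrm2| |].
  - by apply: measurable_funM => //; apply: measurable_sum => s; exact: meas_nrm2.
  - apply: le_trans (nrm2_sum_le _ _) _; rewrite /Nsets cardE enumT; exact: lexx.
have s0 w : 0 <= \sum_s nrm2 (o s w) by apply: sumr_ge0 => s _; exact: nrm2_ge0.
rewrite I_Zl ?ler0n//; last by apply: measurable_sum => s; exact: meas_nrm2.
rewrite [leRHS]EFinM; apply: lee_wpmul2l; first by rewrite lee_fin ler0n.
apply: I_sum_le => [s w|s|s]; [exact: nrm2_ge0|exact: meas_nrm2|].
rewrite /o; have [eq12|ne12] := eqVneq s.1 s.2; last exact: IoffVV.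
by rewrite I_cst nrm2_0 /off_bound eq12 eqxx.
Qed.

End polynomial.

(** * Back to the embedded polynomial and the original random matrices *)

Lemma retr_absmx4 a (M : 'M[C]_a) : retr (absmx M ^+ 4) = nrm2 (M *m M ^t*).
Proof.
have -> : absmx M ^+ 4 = (M *m M ^t*) *m (M *m M ^t*).
  rewrite -absmx_sqr; have -> : absmx M *m absmx M = absmx M ^+ 2 by rewrite expr2.
  by have -> : absmx M ^+ 2 *m absmx M ^+ 2 = absmx M ^+ 2 * absmx M ^+ 2 by []; rewrite -exprD.
by rewrite /nrm2 /ip adjM trmxCK.
Qed.

(** An embedded coefficient is J^* Q(S) J. The common left factor J^* can be pulled out, and being
    an isometry it does not affect the norm. *)
Lemma nceval_ncemb (Q : ncpoly R m n) (X : 'I_m -> 'M[C]_p) :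
  nceval (ncemb p Q) X =
  J ^t* *m \sum_(S : {set 'I_m}) Q S *m J *m \prod_(i < m | i \in S) X i.
Proof.
rewrite /nceval mulmx_sumr; apply: eq_bigr => S _; rewrite ffunE /embmx.
by rewrite tr_pid_mx map_pid_mx !mulmxA.
Qed.

Lemma nrm2_emb a (Z : 'M[C]_(n, a)) :
  nrm2 (J ^t* *m Z *m (J ^t* *m Z) ^t*) = nrm2 (Z *m Z ^t*).
Proof.
rewrite adjM trmxCK mulmxA -(mulmxA (J ^t*)); exact: nrm2_JMJ.
Qed.

Lemma ae_unitary : {ae P, forall w, forall i, (H i w : 'M[C]_p) \is unitarymx}.
Proof.
apply: filter_forall => i.
pose U := [set x : cmx R p | (x : 'M[C]_p) \is unitarymx].
have mU : measurable U := @measurable_unitary R p.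
exists (H i @^-1` (~` U)); split.
- by rewrite -[X in measurable X]setTI; apply: measurable_funPT => //; exact: measurableC.
- have := probability_setC (distribution P (H i)) mU.
  by rewrite (hH i).1 subee.
- by move=> w /=.
Qed.

Section expectation_bound.
Variables (Q : ncpoly R m n) (d : nat).
Hypotheses (c21 : 1 <= c2) (Qd : forall S : {set 'I_m}, (d < #|S|)%N -> Q S = 0).

Lemma expectation_le (e : R) : 0 < e ->
  ('E_P[(fun w => n%:R^-1 * retr (absmx (nceval (ncemb p Q)
     (fun i => amp (G i w) *m (H i w : 'M[C]_p))) ^+ 4))%R] <=
   (n%:R^-1 * ((1 + e) * (\sum_A \sum_B diag_bound Q d A B) +
    (1 + e^-1) * (#|{: {set 'I_m} * {set 'I_m}}|%:R *
      \sum_(s : {set 'I_m} * {set 'I_m}) off_bound Q s.1 s.2)))%:E)%E.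
Proof.
move=> e0; rewrite unlock.
pose Z0 w : 'M[C]_(n, p) := \sum_(S : {set 'I_m}) Q S *m J *m
  \prod_(i < m | i \in S) (amp (G i w) *m (H i w : 'M[C]_p)).
pose Z w : 'M[C]_(n, p) := \sum_(S : {set 'I_m}) Q S *m J *m word E S w.
have -> : (\int[P]_w (n%:R^-1 * retr (absmx (nceval (ncemb p Q)
     (fun i => amp (G i w) *m (H i w : 'M[C]_p))) ^+ 4))%:E =
   I (fun w => n%:R^-1 * nrm2 (Z0 w *m (Z0 w) ^t*)))%E.
  apply: eq_integral => w _; rewrite retr_absmx4 nceval_ncemb nrm2_emb; exact: erefl.
have mZ0 : mxmeas Z0.
  apply: mxmeas_sum => S; apply: mxmeasM; first exact: mxmeas_cst.
  apply: mxmeas_prod => i _ _; apply: mxmeasM; first exact/mxmeas_amp/mxmeas_G.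
  by apply: (mxmeas_comp (@mxmeas_id R p)); exact: measurable_funPT.
have mZ : mxmeas Z.
  by apply: mxmeas_sum => S; apply: mxmeasM; [exact: mxmeas_cst|exact: mxmeas_word].
have ni0 : 0 <= (n%:R^-1 : R) by rewrite invr_ge0 ler0n.
have mn (Y : T -> 'M[C]_(n, p)) : mxmeas Y ->
    measurable_fun setT (fun w => nrm2 (Y w *m (Y w) ^t*)).
  by move=> mY; apply: meas_nrm2; exact: (mxmeasM mY (mxmeas_adj mY)).
(* Passage from H_i to [upart (H i)], which changes the integrand only on a null event. *)
apply: (@le_trans _ _ (I (fun w => n%:R^-1 * nrm2 (Z w *m (Z w) ^t*)))).
  apply: ae_ge0_le_integral => //.
  - by move=> w _; rewrite lee_fin mulr_ge0 ?nrm2_ge0.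
  - by apply/measurable_EFinP; apply: measurable_funM => //; exact: mn.
  - by move=> w _; rewrite lee_fin mulr_ge0 ?nrm2_ge0.
  - by apply/measurable_EFinP; apply: measurable_funM => //; exact: mn.
  - apply: filterS ae_unitary => w uw _.
    suff -> : Z0 w = Z w by exact: lexx.
    apply: eq_bigr => S _; congr (_ *m _); apply: eq_bigr => i _.
    by rewrite /xi (upart_unitary (uw i)).
have nn0 w : 0 <= nrm2 (Z w *m (Z w) ^t*) by exact: nrm2_ge0.
rewrite (I_Zl ni0 nn0 (mn _ mZ)) [leRHS]EFinM; apply: lee_wpmul2l; first by rewrite lee_fin.
exact: second_moment.
Qed.

End expectation_bound.

End model.

(** * Fourier analysis on the cube *)

Section boolean.
Variables (R : realType) (m n : nat) (Q : ncpoly R m n).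
Local Notation C := R[i].
Local Notation signs := {ffun 'I_m -> bool}.

Definition chi (S : {set 'I_m}) (b : signs) : R := \prod_(i in S) (-1) ^+ b i.

Lemma ncsignE b : ncsign Q b = \sum_(S : {set 'I_m}) (chi S b)%:C%C *: Q S.
Proof.
rewrite /ncsign /nceval; apply: eq_bigr => S _.
have -> : \prod_(i < m | i \in S) ((-1) ^+ b i)%:M = ((chi S b)%:C%C)%:M :> 'M[C]_n.
  rewrite /chi rmorph_prod /=.
  rewrite (big_morph (fun z : C => z%:M : 'M[C]_n) (id1 := 1) (op1 := *%R)) //.
    apply: eq_bigr => i _; congr (_%:M).
    by case: (b i); rewrite ?expr0 ?expr1 ?rmorphN1 ?rmorph1.
  by move=> x y; exact: scalar_mxM.
by rewrite mul_mx_scalar.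
Qed.

(** The sum over the cube factors over the coordinates, and a coordinate lying in exactly one of the
    two sets contributes 1 + (-1) = 0. *)
Lemma chi_orthogonal (S S' : {set 'I_m}) :
  \sum_(b : signs) chi S b * chi S' b = if S == S' then 2 ^+ m else 0.
Proof.
pose F (i : 'I_m) (b : bool) : R := ((-1) ^+ b) ^+ (i \in S) * ((-1) ^+ b) ^+ (i \in S').
have chiE (A : {set 'I_m}) b : chi A b = \prod_i ((-1) ^+ b i) ^+ (i \in A).
  by rewrite /chi big_mkcond; apply: eq_bigr => i _; case: (i \in A).
have -> : \sum_(b : signs) chi S b * chi S' b = \sum_(b : signs) \prod_i F i (b i).
  by apply: eq_bigr => b _; rewrite !chiE -big_split.
rewrite -(bigA_distr_bigA F); case: eqP => [eS|SS'].
  rewrite -[in RHS](card_ord m) -prodr_const; apply: eq_bigr => i _.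
  by rewrite big_bool /F eS; case: (i \in S'); rewrite ?expr0 ?expr1 /= ?expr1 ?expr0; ring.
have [i iSS'] : exists i, (i \in S) != (i \in S').
  apply/existsP; apply: contra_notT SS'; rewrite negb_exists => /forallP h.
  by apply/setP => i; apply/eqP; move: (h i); rewrite negbK.
rewrite (bigD1 i)//= big_bool /F; move: iSS'.
by case: (i \in S); case: (i \in S') => //= _; rewrite !expr1 !expr0 ?mulr1 ?mul1r addNr mul0r.
Qed.

Lemma Esign_sum (K : finType) (f : K -> signs -> R) :
  Esign (fun b => \sum_k f k b) = \sum_k Esign (f k).
Proof. by rewrite /Esign exchange_big mulr_sumr. Qed.

Lemma Esign_chi (S S' : {set 'I_m}) (x : R) :
  Esign (fun b => chi S b * chi S' b * x) = if S == S' then x else 0.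
Proof.
rewrite /Esign -mulr_suml chi_orthogonal; case: eqP => _; last by rewrite mul0r mulr0.
by rewrite mulrA mulVf ?mul1r// expf_neq0// pnatr_eq0.
Qed.

Lemma Esign_le (f g : signs -> R) : (forall b, f b <= g b) -> Esign f <= Esign g.
Proof.
move=> fg; rewrite /Esign ler_wpM2l ?invr_ge0 ?exprn_ge0//.
by apply: ler_sum => b _.
Qed.

Lemma card_signs : #|{: signs}| = (2 ^ m)%N.
Proof. by rewrite card_ffun card_bool card_ord. Qed.

Lemma Esign_cst (x : R) : Esign (fun _ : signs => x) = x.
Proof.
by rewrite /Esign sumr_const card_signs -[X in _ * X]mulr_natl natrX mulrA mulVf ?mul1r.
Qed.

Lemma parseval : Esign (fun b => nrm2 (ncsign Q b)) = \sum_S nrm2 (Q S).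
Proof.
have -> : (fun b => nrm2 (ncsign Q b)) = fun b => \sum_S \sum_S' chi S b * chi S' b * ip (Q S) (Q S').
  apply/funext => b; rewrite ncsignE /nrm2 ip_suml; apply: eq_bigr => S _.
  by rewrite ip_sumr; apply: eq_bigr => S' _; rewrite ipZl ipZr mulrA.
rewrite Esign_sum; apply: eq_bigr => S _; rewrite Esign_sum.
rewrite (bigD1 S)//= Esign_chi eqxx big1 ?addr0// => S' SS'.
by rewrite Esign_chi eq_sym (negPf SS').
Qed.

Lemma sum_ncsign : \sum_(b : signs) ncsign Q b *m (ncsign Q b) ^t* =
  (2 ^+ m : R)%:C%C *: \sum_(S : {set 'I_m}) Q S *m (Q S) ^t*.
Proof.
have e b : ncsign Q b *m (ncsign Q b) ^t* = \sum_(S : {set 'I_m}) \sum_(S' : {set 'I_m})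
    (chi S b * chi S' b)%:C%C *: (Q S *m (Q S') ^t*).
  rewrite ncsignE adj_sum mulmx_suml; apply: eq_bigr => S _.
  rewrite mulmx_sumr; apply: eq_bigr => S' _.
  have -> : ((chi S' b)%:C%C *: Q S') ^t* = (chi S' b)%:C%C *: (Q S') ^t*.
    by apply/matrixP => i j; rewrite !mxE rmorphM; congr (_ * _); exact: conjc_real.
  by rewrite -scalemxAl -scalemxAr scalerA rmorphM.
under eq_bigr do rewrite e.
rewrite exchange_big /= scaler_sumr; apply: eq_bigr => S _.
rewrite exchange_big /= (bigD1 S)//= -scaler_suml -rmorph_sum chi_orthogonal eqxx.
rewrite big1 ?addr0// => S' SS'.
by rewrite -scaler_suml -rmorph_sum chi_orthogonal eq_sym (negPf SS') scale0r.
Qed.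

(* Jensen's inequality for [M |-> |M|_2^2] discards every Fourier coefficient of
   [Q(b) Q(b)^*] but the constant one. *)
Lemma Esign_fourth_ge : \sum_(A : {set 'I_m}) \sum_(B : {set 'I_m}) nrm2 ((Q A) ^t* *m Q B) <=
  Esign (fun b => nrm2 (ncsign Q b *m (ncsign Q b) ^t*)).
Proof.
have -> : \sum_A \sum_B nrm2 ((Q A) ^t* *m Q B) = nrm2 (\sum_S Q S *m (Q S) ^t*).
  rewrite {2}/nrm2 ip_suml; apply: eq_bigr => A _; rewrite ip_sumr.
  by apply: eq_bigr => B _; rewrite ip_psd.
have := nrm2_sum_le (index_enum signs) (fun b => ncsign Q b *m (ncsign Q b) ^t*).
rewrite sum_ncsign nrm2Z (_ : size _ = 2 ^ m)%N; last first.
  by rewrite -card_signs cardE enumT.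
rewrite natrX /Esign expr2 -mulrA ler_pM2l ?exprn_gt0// => h.
by rewrite ler_pdivlMl ?exprn_gt0.
Qed.

Hypothesis hQ : forall b, opnorm (ncsign Q b) <= 1.

Lemma ncsign_nrm2 b : nrm2 (ncsign Q b) <= n%:R.
Proof.
have := opnorm_mul 1%:M ler01 (hQ b).
by rewrite mulmx1 expr1n mul1r nrm2_1.
Qed.

Lemma ncsign_fourth b : nrm2 (ncsign Q b *m (ncsign Q b) ^t*) <= n%:R.
Proof.
apply: le_trans (opnorm_mul _ ler01 (hQ b)) _.
by rewrite expr1n mul1r nrm2_adj ncsign_nrm2.
Qed.

Lemma sum_nrm2_le : \sum_S nrm2 (Q S) <= n%:R.
Proof.
by rewrite -parseval -[leRHS]Esign_cst; apply: Esign_le => b; exact: ncsign_nrm2.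
Qed.

Lemma nrm2_coef_le S : nrm2 (Q S) <= n%:R.
Proof.
apply: le_trans sum_nrm2_le; rewrite (bigD1 S)//= lerDl.
by apply: sumr_ge0 => S' _; exact: nrm2_ge0.
Qed.

Definition influence i : R := \sum_(S : {set 'I_m} | i \in S) nrm2 (Q S).

Lemma influence_ge0 i : 0 <= influence i.
Proof. by apply: sumr_ge0 => S _; exact: nrm2_ge0. Qed.

Lemma influence_le i : influence i <= maxinf Q.
Proof. exact: (le_bigmax _ influence i). Qed.

Lemma maxinf_ge0 : 0 <= maxinf Q.
Proof. exact: bigmax_ge_id. Qed.

Lemma maxinf_le : maxinf Q <= n%:R.
Proof.
apply: bigmax_le => [|i _]; first exact: ler0n.
apply: le_trans sum_nrm2_le; rewrite [leRHS](bigID (fun S : {set 'I_m} => i \in S)) /= lerDl.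
by apply: sumr_ge0 => S _; exact: nrm2_ge0.
Qed.

Lemma coef_influence i (S : {set 'I_m}) : i \in S -> nrm2 (Q S) <= maxinf Q.
Proof.
move=> iS; apply: le_trans (influence_le i); rewrite /influence (bigD1 S)//= lerDl.
by apply: sumr_ge0 => S' _; exact: nrm2_ge0.
Qed.

Variable d : nat.
Hypothesis Qd : forall S : {set 'I_m}, (d < #|S|)%N -> Q S = 0.

Lemma nrm2_coef0 (S : {set 'I_m}) : (d < #|S|)%N -> nrm2 (Q S) = 0.
Proof. by move=> /Qd ->; rewrite /nrm2 /ip mul0mx mxtrace0. Qed.

(** Double counting: a set S is counted |S| times, and at most [d] times when its coefficient is
    nonzero. *)
Lemma sum_influence : \sum_i influence i <= d%:R * n%:R.
Proof.
rewrite /influence (exchange_big_dep predT) //=.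
apply: (@le_trans _ _ (d%:R * \sum_S nrm2 (Q S))); last first.
  by rewrite ler_wpM2l ?ler0n// sum_nrm2_le.
rewrite mulr_sumr; apply: ler_sum => S _; rewrite sumr_const -[leLHS]mulr_natl.
have [Sd|/nrm2_coef0 ->] := leqP #|S| d; last by rewrite !mulr0.
by rewrite ler_wpM2r ?nrm2_ge0// ler_nat.
Qed.

(** The indicator that A meets B is at most the number of common indices. Summing over that index
    first bounds the left side by the sum of the squared influences, one factor of which is at most
    [maxinf Q]. *)
Lemma sum_meeting : \sum_(A : {set 'I_m}) \sum_(B : {set 'I_m})
  (if A :&: B == finset.set0 then 0 else nrm2 (Q A) * nrm2 (Q B)) <=
  maxinf Q * (d%:R * n%:R).
Proof.
pose ind (A : {set 'I_m}) i : R := (i \in A)%:R * nrm2 (Q A).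
have indE i : \sum_A ind A i = influence i.
  rewrite /influence [RHS]big_mkcond; apply: eq_bigr => A _; rewrite /ind.
  by case: (i \in A); rewrite ?mul1r ?mul0r.
have ind0 A i : 0 <= ind A i by rewrite mulr_ge0 ?ler0n ?nrm2_ge0.
apply: (@le_trans _ _ (\sum_A \sum_B \sum_i ind A i * ind B i)).
  apply: ler_sum => A _; apply: ler_sum => B _; case: ifPn => [_|].
    by apply: sumr_ge0 => i _; rewrite mulr_ge0.
  case/set0Pn => i; rewrite inE => /andP[iA iB].
  rewrite (bigD1 i)//= {1 2}/ind iA iB !mul1r lerDl.
  by apply: sumr_ge0 => j _; rewrite mulr_ge0.
under eq_bigr do rewrite exchange_big /=.
rewrite exchange_big /=.
apply: (@le_trans _ _ (\sum_i maxinf Q * influence i)); last first.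
  by rewrite -mulr_sumr ler_wpM2l ?maxinf_ge0// sum_influence.
apply: ler_sum => i _; under eq_bigr do rewrite -mulr_sumr.
by rewrite -mulr_suml indE ler_wpM2r ?influence_ge0// influence_le.
Qed.

Lemma sum_diag_bound c2 : 0 <= c2 ->
  \sum_(A : {set 'I_m}) \sum_(B : {set 'I_m}) diag_bound c2 Q d A B <=
  Esign (fun b => nrm2 (ncsign Q b *m (ncsign Q b) ^t*)) +
  maxinf Q * (d%:R * n%:R) * (c2 ^+ d * n%:R).
Proof.
move=> c0; have z0 : 0 <= c2 ^+ d * n%:R by rewrite mulr_ge0 ?exprn_ge0 ?ler0n.
apply: le_trans (lerD Esign_fourth_ge (ler_wpM2r z0 sum_meeting)).
rewrite mulr_suml -big_split; apply: ler_sum => A _ /=.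
rewrite mulr_suml -big_split; apply: ler_sum => B _ /=.
rewrite /diag_bound; case: ifP => _; first by rewrite mul0r addr0.
by rewrite lerDr nrm2_ge0.
Qed.

(** If S and S' are disjoint, [c2] has exponent 0 and each coefficient is at most n in squared norm.
    Otherwise a common index bounds both squared norms by [maxinf Q]. *)
Lemma off_bound_le k c2 (S S' : {set 'I_m}) : 1 <= c2 ->
  off_bound k c2 Q S S' <= (n * k)%:R^-1 * (n%:R ^+ (2 + 2 * m) *
     (n%:R ^+ 2 + maxinf Q ^+ 2 * c2 ^+ d)).
Proof.
move=> c1; have c0 : 0 <= c2 by exact: le_trans c1.
have cd0 : 0 <= c2 ^+ d by rewrite exprn_ge0.
have rhs0 : 0 <= (n * k)%:R^-1 * (n%:R ^+ (2 + 2 * m) *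
     (n%:R ^+ 2 + maxinf Q ^+ 2 * c2 ^+ d)).
  apply: mulr_ge0; first by rewrite invr_ge0 ler0n.
  apply: mulr_ge0; first by rewrite exprn_ge0 ?ler0n.
  apply: addr_ge0; first by rewrite exprn_ge0 ?ler0n.
  by apply: mulr_ge0 cd0; rewrite exprn_ge0 ?maxinf_ge0.
rewrite /off_bound; case: ifP => // _.
have [Sd|/nrm2_coef0 ->] := leqP #|S| d; last by rewrite !mul0r.
suff h : nrm2 (Q S) * nrm2 (Q S') * c2 ^+ #|S :&: S'| <= n%:R ^+ 2 + maxinf Q ^+ 2 * c2 ^+ d.
  apply: le_trans (_ : (n * k)%:R^-1 * (n%:R ^+ (2 + 2 * m) *
    (nrm2 (Q S) * nrm2 (Q S') * c2 ^+ #|S :&: S'|)) <= _); last first.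
    by rewrite !ler_wpM2l ?invr_ge0 ?exprn_ge0 ?ler0n.
  rewrite exprD; move: (nrm2 _) (nrm2 _) (_^-1) (_ ^+ _) (_ ^+ _) (_ ^+ _) => a b u v w x.
  by rewrite le_eqVlt; apply/orP; left; apply/eqP; ring.
have [->|meet] := eqVneq (S :&: S') finset.set0.
  rewrite cards0 expr0 mulr1; apply: le_trans (_ : n%:R ^+ 2 <= _).
    by rewrite expr2 ler_pM ?nrm2_ge0 ?nrm2_coef_le.
  by rewrite lerDl mulr_ge0 ?exprn_ge0 ?maxinf_ge0.
case/set0Pn: meet => i; rewrite inE => /andP[iS iS'].
apply: le_trans (_ : maxinf Q ^+ 2 * c2 ^+ d <= _).
  apply: ler_pM; rewrite ?mulr_ge0 ?nrm2_ge0 ?exprn_ge0//.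
    by rewrite expr2 ler_pM ?nrm2_ge0 ?(coef_influence iS) ?(coef_influence iS').
  rewrite ler_weXn2l//; apply: leq_trans Sd; apply: subset_leq_card; exact: subsetIl.
by rewrite lerDr exprn_ge0 ?ler0n.
Qed.

End boolean.

(** * The bound *)

Section final.
Variable R : realType.

(** Real arithmetic, to be read with nr = n, e = p^{-1/2}, [Es] the normalized Boolean fourth
    moment, t = tau^{1/4}, c = c_2^d, D = (8 c_2)^{4d}, dr = d, [N] the number of pairs of sets and
    K1 = n^{2+2m}. *)
Lemma final_bound (nr e Es t c D dr N K1 : R) :
  1 <= nr -> 0 < e <= 1 -> Es <= 1 -> 0 <= t <= nr -> 0 <= N -> 0 <= K1 -> 0 <= dr ->
  1 <= c -> dr * c <= D -> c ^+ 2 <= D ->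
  nr^-1 * ((1 + e) * (nr * Es + t ^+ 4 * (dr * nr) * (c * nr)) +
    (1 + e^-1) * (N * (N * (e ^+ 2 * (K1 * (nr ^+ 2 + (t ^+ 4) ^+ 2 * c)))))) <=
  Es + 8 * D * nr ^+ 4 * t +
  (1 + 2 * (N ^+ 2 * K1 * nr ^+ 2) + 2 * ((N ^+ 2 * K1 * nr ^+ 7) ^+ 2 * nr)) * e.
Proof.
move=> n1 /andP[e0 e1] Es1 /andP[t0 tn] N0 K10 d0 c1 dcD ccD.
have n0 : 0 < nr by lra.
have c0 : 0 < c by lra.
have D0 : 0 <= D by apply: le_trans ccD; exact: sqr_ge0.
pose K := N ^+ 2 * K1; have K0 : 0 <= K by rewrite mulr_ge0 ?exprn_ge0.
have -> : nr^-1 * ((1 + e) * (nr * Es + t ^+ 4 * (dr * nr) * (c * nr)) +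
    (1 + e^-1) * (N * (N * (e ^+ 2 * (K1 * (nr ^+ 2 + (t ^+ 4) ^+ 2 * c)))))) =
  (1 + e) * (Es + t ^+ 4 * nr * (dr * c)) +
  (e ^+ 2 + e) * (nr^-1 * (K * (nr ^+ 2 + t ^+ 8 * c))).
  by rewrite /K; field; rewrite !gt_eqF.
have ee : e ^+ 2 <= e by rewrite expr2 ler_piMl// ltW.
(* As t <= n, surplus powers of t are exchanged for powers of n, leaving the single power
   tau^{1/4}. *)
have tpow j : t ^+ j.+1 <= nr ^+ j * t.
  by rewrite exprS mulrC ler_wpM2r// lerXn2r ?nnegrE// ltW.
have h1 : t ^+ 4 * nr * (dr * c) <= nr ^+ 4 * t * D.
  apply: ler_pM => //; rewrite ?mulr_ge0 ?exprn_ge0// ?(ltW n0) ?(ltW c0)//.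
  have -> : nr ^+ 4 * t = nr ^+ 3 * t * nr by ring.
  by rewrite ler_pM2r// tpow.
have y0 : 0 <= t ^+ 4 * nr * (dr * c).
  by rewrite !mulr_ge0 ?exprn_ge0// ?(ltW n0) ?(ltW c0).
have z0 : 0 <= K * (nr ^+ 2 + t ^+ 8 * c).
  by rewrite mulr_ge0// addr_ge0 ?mulr_ge0 ?exprn_ge0// ?(ltW n0) ?(ltW c0).
have h2 : (e ^+ 2 + e) * (nr^-1 * (K * (nr ^+ 2 + t ^+ 8 * c))) <=
    2 * e * (K * (nr ^+ 2 + t ^+ 8 * c)).
  have inv0 : 0 <= nr^-1 by rewrite invr_ge0 (ltW n0).
  apply: ler_pM.
  - by rewrite addr_ge0 ?exprn_ge0 ?(ltW e0).
  - exact: mulr_ge0.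
  - by move: ee; move: (e ^+ 2) => u; lra.
  - by rewrite ler_piMl// invf_le1.
have h3 : (1 + e) * (Es + t ^+ 4 * nr * (dr * c)) <= Es + e + 2 * (nr ^+ 4 * t * D).
  have a1 : e * Es <= e by rewrite ler_piMr// ltW.
  have a2 : e * (t ^+ 4 * nr * (dr * c)) <= t ^+ 4 * nr * (dr * c) by rewrite ler_piMl.
  rewrite mulrDl mul1r mulrDr; move: a1 a2 h1.
  by move: (e * Es) (e * _) (t ^+ 4 * _ * _) (_ * t * D) => u1 u2 u3 u4; lra.
pose K' := K * nr ^+ 7; have K'0 : 0 <= K' by rewrite mulr_ge0 ?exprn_ge0 ?(ltW n0).
have n40 : 0 <= nr ^+ 4 by rewrite exprn_ge0 ?(ltW n0).
have h4 : 2 * e * (K * (t ^+ 8 * c)) <= 2 * (nr ^+ 4 * t * D) + 2 * (K' ^+ 2 * nr) * e.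
  have b1 : K * (t ^+ 8 * c) <= K' * c * t.
    have -> : K' * c * t = K * (nr ^+ 7 * t * c) by rewrite /K'; ring.
    by rewrite ler_wpM2l// ler_pM2r// tpow.
  have kct0 : 0 <= K' * c * t.
    by apply: mulr_ge0 t0; apply: mulr_ge0 K'0 _; exact: ltW.
  have kk0 : 0 <= K' ^+ 2 * nr by apply: mulr_ge0 (sqr_ge0 _) _; exact: ltW.
  have b2 : e * (K * (t ^+ 8 * c)) <= e * (K' * c * t) by rewrite ler_wpM2l// ltW.
  (* Either K' c <= D, and the term fits into the influence term, or c^2 <= D < K' c forces c <= K'.
     In the second case c is bounded in terms of m and n only, and the term joins the error in
     [e]. *)
  have [kc|kc] := lerP (K' * c) D.
    have b3 : K' * c * t <= nr ^+ 4 * t * D.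
      apply: le_trans (_ : D * t <= _); first by rewrite ler_wpM2r.
      have -> : nr ^+ 4 * t * D = nr ^+ 4 * (D * t) by ring.
      by rewrite ler_peMl ?mulr_ge0// exprn_ege1.
    have b4 : e * (K' * c * t) <= K' * c * t by rewrite ler_piMl.
    have b5 : 0 <= 2 * (K' ^+ 2 * nr) * e.
      by apply: mulr_ge0 (ltW e0); apply: mulr_ge0 kk0.
    rewrite -[2 * e * (K * _)]mulrA; move: b2 b3 b4 b5.
    move: (e * (K * _)) (e * (K' * c * t)) (K' * c * t) (nr ^+ 4 * t * D) (2 * _ * e).
    by move=> u1 u2 u3 u4 u5; lra.
  have cK : c <= K'.
    have : c * c <= K' * c by rewrite -expr2; apply: le_trans ccD _; exact: ltW.
    by rewrite ler_pM2r.
  have b3 : K' * c * t <= K' ^+ 2 * nr.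
    apply: ler_pM => //; first by apply: mulr_ge0 K'0 _; exact: ltW.
    by rewrite expr2 ler_wpM2l.
  have b4 : e * (K' * c * t) <= e * (K' ^+ 2 * nr) by rewrite ler_wpM2l// ltW.
  have b5 : 0 <= nr ^+ 4 * t * D by apply: mulr_ge0 D0; exact: mulr_ge0.
  rewrite -[2 * e * (K * _)]mulrA -[2 * (K' ^+ 2 * nr) * e]mulrA [K' ^+ 2 * nr * e]mulrC.
  move: b2 b4 b5.
  move: (e * (K * _)) (e * (K' * c * t)) (e * (K' ^+ 2 * nr)) (nr ^+ 4 * t * D).
  by move=> u1 u2 u3 u4; lra.
apply: le_trans (lerD h3 h2) _; rewrite mulrDr [2 * e * _]mulrDr -/K -/K'.
have -> : 2 * e * (K * nr ^+ 2) = 2 * (K * nr ^+ 2) * e by ring.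
have -> : 8 * D * nr ^+ 4 * t = 8 * (nr ^+ 4 * t * D) by ring.
(* [h3] and [h4] use two copies each of the eight available; the rest is slack. *)
have n8 : 0 <= nr ^+ 4 * t * D by apply: mulr_ge0 D0; exact: mulr_ge0.
move: h4 n8; rewrite [X in _ -> _ -> _ <= _ + X]mulrDl [X in _ -> _ -> _ <= _ + (X + _)]mulrDl mul1r.
move: (2 * e * (K * _)) (nr ^+ 4 * t * D) (2 * (K' ^+ 2 * nr) * e) (2 * (K * nr ^+ 2) * e).
by move=> u1 u2 u3 u4; lra.
Qed.

(** The first bound, by d <= 2^d <= 8^d, serves the diagonal terms with meeting sets; the second
    lets the influence term absorb an off-diagonal term when [c2] is large. *)
Lemma pow_bounds (c2 : R) d : 1 <= c2 ->
  d%:R * c2 ^+ d <= (8 * c2) ^+ (4 * d) /\ (c2 ^+ d) ^+ 2 <= (8 * c2) ^+ (4 * d).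
Proof.
move=> c1; have c0 : 0 <= c2 by lra.
rewrite exprMn; split.
  apply: ler_pM; rewrite ?ler0n ?exprn_ge0//.
    apply: le_trans (_ : (2 ^ d)%:R <= _); first by rewrite ler_nat ltnW// ltn_expl.
    rewrite natrX; apply: le_trans (_ : (8 : R) ^+ d <= _).
      by rewrite lerXn2r ?nnegrE ?ler0n// ler_nat.
    by rewrite ler_weXn2l ?ler1n// leq_pmull.
  by rewrite ler_weXn2l// leq_pmull.
rewrite -exprM; apply: le_trans (_ : c2 ^+ (4 * d) <= _).
  by rewrite ler_weXn2l// mulnC leq_mul2r orbT.
by rewrite ler_peMl ?exprn_ge0// exprn_ege1// ler1n.
Qed.

End final.

Theorem theorem1p1 (R : realType) (m n : nat) (hm : (0 < m)%N) (hn : (0 < n)%N) :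
  exists C : R, 0 < C /\
  forall (d k : nat) (hd : (0 < d)%N) (hk : (0 < k)%N)
    (Q : ncpoly R m n) (hdeg : ncdeg Q = d)
    (hQ : forall b : {ffun 'I_m -> bool}, opnorm (ncsign Q b) <= 1)
    (calG : probability (cmx R n) R)
    (hG1_int : mx_integrable calG (fun M : 'M[R[i]]_n => M))
    (hG1 : Emx calG (fun M : 'M[R[i]]_n => M) = 0)
    (hG2_int : mx_integrable calG (fun M : 'M[R[i]]_n => M *m M ^t*))
    (hG2 : Emx calG (fun M : 'M[R[i]]_n => M *m M ^t*) = 1%:M)
    (c2 : R) (hc2 : 1 <= c2)
    (hG4_int : mx_integrable calG (fun M : 'M[R[i]]_n => (M *m M ^t*) ^+ 2))
    (hG4 : opnorm (Emx calG (fun M : 'M[R[i]]_n => (M *m M ^t*) ^+ 2)) <= c2)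
    (disp : measure_display) (T : measurableType disp) (P : probability T R)
    (G : 'I_m -> {RV P >-> cmx R n}) (H : 'I_m -> {RV P >-> cmx R (n * k)})
    (hG : forall i, has_distribution (G i) calG)
    (hH : forall i, haar_unitary (distribution P (H i)))
    (hindep : independent_GH G H),
  ('E_P[(fun w => n%:R^-1 * retr (absmx (nceval (ncemb (n * k) Q)
          (fun i => ((G i w : 'M[R[i]]_n) *t (1%:M : 'M[R[i]]_k)) *m
                    (H i w : 'M[R[i]]_(n * k)))) ^+ 4))%R]
   <= (Esign (fun b => n%:R^-1 * retr (absmx (ncsign Q b) ^+ 4))
       + 8 * (8 * c2) ^+ (4 * d) * n%:R ^+ 4 * maxinf Q `^ (4^-1)
       + C * (n * k)%:R `^ (- 2^-1))%R%:E)%E.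
Proof.
pose N : R := #|{: {set 'I_m} * {set 'I_m}}|%:R.
pose K1 : R := n%:R ^+ (2 + 2 * m).
have n1 : (1 : R) <= n%:R by rewrite ler1n.
have n0 : (0 : R) <= n%:R by exact: ler0n.
have K10 : 0 <= K1 by rewrite exprn_ge0.
have N0 : 0 <= N by exact: ler0n.
(* The three summands come from e times the Boolean moment, from the off-diagonal part free of [c2],
   and from its part with [c2] when c_2^d is at most N^2 K1 n^7. *)
exists (1 + 2 * (N ^+ 2 * K1 * n%:R ^+ 2) + 2 * ((N ^+ 2 * K1 * n%:R ^+ 7) ^+ 2 * n%:R)).
split.
  have a0 : 0 <= N ^+ 2 * K1 * n%:R ^+ 2.
    by apply: mulr_ge0 (sqr_ge0 _); apply: mulr_ge0 (sqr_ge0 _) K10.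
  have b0 : 0 <= (N ^+ 2 * K1 * n%:R ^+ 7) ^+ 2 * n%:R.
    by apply: mulr_ge0 n0; exact: sqr_ge0.
  move: a0 b0; move: (N ^+ 2 * K1 * n%:R ^+ 2) (_ ^+ 2 * n%:R) => a b a0 b0.
  by lra.
move=> d k hd hk Q hdeg hQ calG _ _ hG2_int hG2 c2 hc2 hG4_int hG4 disp T P G H hG hH hindep.
have c20 : 0 <= c2 by lra.
have Qd (S : {set 'I_m}) : (d < #|S|)%N -> Q S = 0.
  move=> dS; apply/eqP; apply: contraTT dS => QS; rewrite -leqNgt -hdeg.
  exact: (@leq_bigmax_cond _ (fun S => Q S != 0) (fun S : {set 'I_m} => #|S|) S QS).
(* The weight balancing e on the diagonal part against e^-1 / p on the off-diagonal part. *)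
pose e : R := (n * k)%:R `^ (- 2^-1).
have p0 : (0 : R) < (n * k)%:R by rewrite ltr0n muln_gt0 hn.
have e0 : 0 < e by exact: powR_gt0.
have e2 : e ^+ 2 = (n * k)%:R^-1.
  by rewrite /e powRN exprVn powR12_sqrt ?ler0n// sqr_sqrtr ?ler0n.
have e1 : e <= 1.
  by rewrite -(@expr_le1 _ 2)// ?(ltW e0)// e2 invf_le1// ler1n muln_gt0 hn.
pose t := maxinf Q `^ 4^-1.
have t0 : 0 <= t by exact: powR_ge0.
have t4 : t ^+ 4 = maxinf Q.
  by rewrite /t -powR_mulrn ?powR_ge0// -powRrM mulVf ?pnatr_eq0// powRr1 ?maxinf_ge0.
have tn : t <= n%:R.
  rewrite -(@ler_pXn2r _ 4)// ?nnegrE// t4; apply: le_trans (maxinf_le hQ) _.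
  by rewrite ler_eXnr.
pose Es := Esign (fun b => n%:R^-1 * retr (absmx (ncsign Q b) ^+ 4)).
have nEs : n%:R * Es = Esign (fun b => nrm2 (ncsign Q b *m (ncsign Q b) ^t*)).
  rewrite /Es /Esign mulrCA; congr (_ * _); rewrite mulr_sumr; apply: eq_bigr => b _.
  by rewrite mulrA mulfV ?pnatr_eq0 -?lt0n// mul1r retr_absmx4.
have Es1 : Es <= 1.
  rewrite -(@ler_pM2l _ n%:R) ?ltr0n// nEs mulr1 -[leRHS](Esign_cst m).
  by apply: Esign_le => b; exact: ncsign_fourth.
have [pb1 pb2] := pow_bounds d hc2.
apply: le_trans (expectation_le c20 hG2_int hG2 hG4_int hG4 hG hH hindep hk hn hc2 Qd e0) _.
rewrite lee_fin -/N -/e -/t -/Es.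
have := @final_bound R n%:R e Es t (c2 ^+ d) ((8 * c2) ^+ (4 * d)) d%:R N K1
  n1 _ Es1 _ N0 K10 (ler0n _ _) (exprn_ege1 _ hc2) pb1 pb2.
rewrite e0 e1 t0 tn => /(_ isT isT); apply: le_trans.
rewrite ler_wpM2l ?invr_ge0//; apply: lerD.
  rewrite ler_wpM2l ?addr_ge0 ?(ltW e0)// nEs t4.
  exact: sum_diag_bound.
rewrite ler_wpM2l ?addr_ge0 ?invr_ge0 ?(ltW e0)// ler_wpM2l//.
apply: (@le_trans _ _ (\sum_(s : {set 'I_m} * {set 'I_m})
  ((n * k)%:R^-1 * (K1 * (n%:R ^+ 2 + maxinf Q ^+ 2 * c2 ^+ d))))).
  by apply: ler_sum => s _; exact: off_bound_le.
rewrite sumr_const -[leLHS]mulr_natl e2 t4 -/N; exact: lexx.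
Qed.
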